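(* Under the global-time impatient semantics, the following problem is undecidable: given a durational labelled Petri net $N$ and two durational markings $M, M'$ of $N$, decide whether $M$ and $M'$ are performance equivalent.
   Context: A labelled Petri net $N$ consists of a finite set $\mathcal{P}$ of places, a finite set $\mathcal{L}$ of labels, and a finite set of transition rules $X \overset{a}{\leadsto} Y$, where $X, Y$ are finite multisets over $\mathcal{P}$ ($X$ nonempty) and $a \in \mathcal{L}$. A durational net additionally assigns to each rule $r$ a duration $\mathrm{dur}(r)$, a positive natural number (duration $0$ is not allowed). A durational marking is a finite multiset over $\mathcal{P}\times\mathbb{N}$; an element $(p,t)$ is written $t \triangleright p$ (a token on place $p$ with time-stamp $t$). For a durational marking $M$, $\mathrm{untime}(M)$ is the multiset over $\mathcal{P}$ obtained by forgetting time-stamps, and $\mathrm{stamps}(M)=\{t : t\triangleright p\in M\}$ (a set). In the local-time impatient semantics, a rule $X\overset{a}{\leadsto}Y$ is fireable in $M$ at time $t$ due to a submarking $\bar X$ if $\bar X\le M$, $\mathrm{untime}(\bar X)=X$ and $\mathrm{stamps}(\bar X)=\{t\}$. In the global-time impatient semantics, a rule is fireable in $M$ at time $t$ due to $\bar X$ if it is so in the local-time impatient semantics and $t$ is the smallest value among all choices of a rule and a submarking fireable in $M$ in the local-time impatient sense. Whenever a rule $r=(X\overset{a}{\leadsto}Y)$ is fireable in $M$ at time $t$ due to $\bar X$, the induced labelled transition system (whose states are durational markings and labels are pairs in $\mathcal{L}\times\mathbb{N}$) has a transition $M \xrightarrow{a,t} M'$ with $M' = M - \bar X + \{(t+\mathrm{dur}(r))\triangleright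 p : p\in Y\}$. Two durational markings are performance equivalent if they are bisimilar (in the standard strong bisimulation sense) as states of this induced labelled transition system. *)

(* Defs.v *)
From HB Require Import structures.
From mathcomp Require Import all_boot.
From mathcomp Require Import finmap multiset.

Set Implicit Arguments.
Unset Strict Implicit.
Unset Printing Implicit Defensive.

Local Open Scope fset_scope.
Local Open Scope fmap_scope.
Local Open Scope mset_scope.
Local Open Scope nat_scope.

Section Bisimilarity.

Variables (S A : Type) (step : S -> A -> S -> Prop).

Definition bisimulation (R : S -> S -> Prop) : Prop :=
  forall s t, R s t ->
    (forall a s', step s a s' -> exists2 t', step t a t' & R s' t') /\
    (forall a t', step t a t' -> exists2 s', step s a s' & R s' t').

Definition bisimilar (s t : S) : Prop := exists2 R, bisimulation R & R s t.

End Bisimilarity.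

Definition mset_map (T U : choiceType) (f : T -> U) (X : {mset T}) : {mset U} :=
  seq_mset [seq f x | x <- X].

Section DurationalNets.

Variables P L : finType.

(* ((X, a), Y) is the rule X ~a~> Y. *)
Definition rule := ({mset P} * L * {mset P})%type.
Definition pre (r : rule) : {mset P} := r.1.1.
Definition lab (r : rule) : L := r.1.2.
Definition post (r : rule) : {mset P} := r.2.

(* The domain of the finite map is the set of rules of the net; its value at a
   rule is the duration of that rule. *)
Record dnet := DNet {
  dur : {fmap rule -> nat};
  pre_nonempty : all (fun r => pre r != mset0) (domf dur);
  dur_positive : 0 \notin codomf dur }.

(* (p, t) is a token on place p with time-stamp t. *)
Definition token := (P * nat)%type.
Definition marking := {mset token}.

Definition untime (M : marking) : {mset P} := mset_map fst M.
Definition stamps (M : marking) : {fset nat} := [fset x.2 | x in finsupp M].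

Variable N : dnet.

Definition fireable_local (M : marking) (r : rule) (t : nat) (X : marking) : Prop :=
  [/\ r \in domf (dur N), X `<=` M, untime X = pre r & stamps X = [fset t]].

Definition fireable_global (M : marking) (r : rule) (t : nat) (X : marking) : Prop :=
  fireable_local M r t X /\
  forall r' t' X', fireable_local M r' t' X' -> t <= t'.

Definition step_global (M : marking) (at_ : L * nat) (M' : marking) : Prop :=
  exists r X d,
    [/\ fireable_global M r at_.2 X, lab r = at_.1, (dur N).[? r] = Some d
      & M' = (M `\` X) `+` mset_map (fun p => (p, at_.2 + d)) (post r)].

Definition performance_equivalent (M M' : marking) : Prop :=
  bisimilar step_global M M'.

End DurationalNets.

(* Minsky register machines: a machine halts when its program counter leaves
   the program. *)
Inductive instr : Type :=
  | Inc (r next : nat)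
  | Dec (r next_pos next_zero : nat).

Definition machine := seq instr.
Definition config := (nat * (nat -> nat))%type.

Definition set_reg (R : nat -> nat) (r v : nat) : nat -> nat :=
  fun i => if i == r then v else R i.

Definition mstep (D : machine) (c : config) : option config :=
  match onth D c.1 with
  | None => None
  | Some (Inc r q) => Some (q, set_reg c.2 r (c.2 r).+1)
  | Some (Dec r q q0) =>
      if c.2 r is v.+1 then Some (q, set_reg c.2 r v) else Some (q0, c.2)
  end.

Inductive halts_with (D : machine) : config -> nat -> Prop :=
  | Halt c : mstep D c = None -> halts_with D c (c.2 0)
  | Run c c' y : mstep D c = Some c' -> halts_with D c' y -> halts_with D c y.

Definition outputs (D : machine) (x y : nat) : Prop :=
  halts_with D (0, set_reg (fun=> 0) 0 x) y.

(* The input of a decision procedure is a natural number presenting the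
   instance. An instance may have several codes (e.g. the elements of a multiset
   can be listed in any order); a decision procedure has to answer correctly on
   each of them and is unconstrained on numbers that code no instance. *)
Definition decides (I : Type) (is_code : I -> nat -> Prop) (Q : I -> Prop)
    (D : machine) : Prop :=
  forall i c, is_code i c ->
    (Q i -> outputs D c 1) /\ (~ Q i -> outputs D c 0).

Definition decidable_problem (I : Type) (is_code : I -> nat -> Prop)
    (Q : I -> Prop) : Prop :=
  exists D, decides is_code Q D.

(* Places and labels are numbered, so that nets have finite presentations. *)
Record instance := Instance {
  nplaces : nat;
  nlabels : nat;
  inet : dnet 'I_nplaces 'I_nlabels;
  imark1 : marking 'I_nplaces;
  imark2 : marking 'I_nplaces }.

(* CodeSeq.code is an effective bijection from seq nat to nat. *)
Local Notation code := CodeSeq.code.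

Definition mset_code (T : choiceType) (f : T -> nat) (X : {mset T}) (c : nat) : Prop :=
  exists2 s : seq T, seq_mset s = X & c = code [seq f x | x <- s].

Definition token_code (n : nat) (x : token 'I_n) : nat :=
  code [:: x.1 : nat; x.2].

Definition rule_code (n m : nat) (r : rule 'I_n 'I_m) (d c : nat) : Prop :=
  exists cx cy,
    [/\ mset_code val (pre r) cx, mset_code val (post r) cy
      & c = code [:: cx; lab r : nat; cy; d]].

Definition net_code (n m : nat) (N : dnet 'I_n 'I_m) (c : nat) : Prop :=
  exists (rs : seq (rule 'I_n 'I_m)) (f : rule 'I_n 'I_m -> nat),
    [/\ uniq rs, rs =i domf (dur N),
        forall r d, (dur N).[? r] = Some d -> rule_code r d (f r)
      & c = code [seq f r | r <- rs]].

Definition instance_code (i : instance) (c : nat) : Prop :=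
  exists cN c1 c2,
    [/\ net_code (inet i) cN,
        mset_code (@token_code _) (imark1 i) c1,
        mset_code (@token_code _) (imark2 i) c2
      & c = code [:: nplaces i; nlabels i; cN; c1; c2]].

Definition equivalent_markings (i : instance) : Prop :=
  performance_equivalent (inet i) (imark1 i) (imark2 i).

(* Main.v *)
(** Jancar's bisimulation game, adapted to tokens that must be renewed at every
    time unit.  All durations are 1, so only two consecutive time-stamps matter:
    a state is a pair (tokens at t, tokens at t + 1), and time advances when no
    rule is enabled at t.  The two markings simulate the same register machine
    and differ only in a marker (true or false); only the marker true can fire
    the halting rule.  A counter token is renewed by C i -> C i.

    At a zero test the state is the triple A m, Z, S.  The attacker may cheat in
    two ways.  If he claims zero while a token C i is still there, the defender
    answers by consuming that token and copying the attacker's marker; S, which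
    carries the label of a renewal, then stands in for the consumed token.  If
    he first renews all tokens C i, the defender combines the last renewal with
    A, which leaves the marker X m at t + 1, and later answers with Z + S alone:
    Y q0 joins X m, and the two sides coincide.  Without a token C i neither
    answer exists, and Y q0 without a marker is dead.  Hence the markings are
    equivalent iff the machine does not halt.

    Undecidability follows by diagonalisation without a universal machine.  A
    code bounds everything that it lists, so the code x of a net may also serve
    as its number of places and of labels, and the instance consisting of net x
    with input x is computed from x by iterating m |-> 2^k (2 m + 1).  The
    machine that runs an alleged decision procedure on this instance and halts
    iff the answer is "equivalent" contradicts it on the code of its own net. *)

From Stdlib Require Import FunctionalExtensionality.
From mathcomp Require Import all_boot.
From mathcomp Require Import finmap multiset zify.
Require Import Defs.

Set Implicit Arguments.
Unset Strict Implicit.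
Unset Printing Implicit Defensive.

Lemma bisimilar_sym (S A : Type) (step : S -> A -> S -> Prop) s t :
  bisimilar step s t -> bisimilar step t s.
Proof.
move=> [R bR st]; exists (fun x y => R y x) => // x y /bR[h1 h2].
by split=> [a x' /h2|a y' /h1].
Qed.

Lemma bisimilar_fwd (S A : Type) (step : S -> A -> S -> Prop) s t a s' :
  bisimilar step s t -> step s a s' -> exists2 t', step t a t' & bisimilar step s' t'.
Proof.
move=> [R bR st] h; have [t' ht' R'] := (bR _ _ st).1 _ _ h.
by exists t' => //; exists R.
Qed.

Definition halts (D : machine) (c : config) : Prop := exists y, halts_with D c y.

Lemma halts_step (D : machine) c c' : mstep D c = Some c' -> halts D c <-> halts D c'.
Proof.
move=> e; split=> -[y h]; exists y; last exact: Run e h.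
by case: h e => [? ->//|? ? ? -> h [<-]].
Qed.

(* Y q, X m: the machine is about to execute instruction q, with marker m;
   A m q, Z q, S q: it is testing the register of the Dec instruction q;
   C i: one unit of register i. *)
Definition place := (nat * nat)%type.
Definition pY (q : nat) : place := (0, q).
Definition pX (m : bool) : place := (1, m : nat).
Definition pZ (q : nat) : place := (2, q).
Definition pS (q : nat) : place := (3, q).
Definition pC (i : nat) : place := (4, i).
Definition pA (m : bool) (q : nat) : place := ((m : nat).+4.+1, q).

Definition vec := place -> nat.
Definition add (l : seq place) (V : vec) : vec := fun p => count_mem p l + V p.
Definition sub (V : vec) (l : seq place) : vec := fun p => V p - count_mem p l.
Definition vec0 : vec := fun=> 0.
Definition enabled (V : vec) (l : seq place) : bool := all (fun p => 0 < V p) l.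

Definition l_tau := 0.
Definition l_dec := 1.
Definition l_zero := 2.
Definition l_halt := 3.
Definition l_tick (i : nat) := i.+4.

Inductive net_rule (D : machine) (K : nat) : seq place -> nat -> seq place -> Prop :=
| RIncr q i q1 m : onth D q = Some (Inc i q1) ->
    net_rule D K [:: pY q; pX m] l_tau [:: pY q1; pX m; pC i]
| RTest q i q1 q0 m : onth D q = Some (Dec i q1 q0) ->
    net_rule D K [:: pY q; pX m] l_tau [:: pA m q; pZ q; pS q]
| RDecr q i q1 q0 m : onth D q = Some (Dec i q1 q0) ->
    net_rule D K [:: pA m q; pZ q; pS q; pC i] l_dec [:: pY q1; pX m]
| RZero q i q1 q0 m : onth D q = Some (Dec i q1 q0) ->
    net_rule D K [:: pA m q; pZ q; pS q] l_zero [:: pY q0; pX m]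
| RSwap q i q1 q0 m m' : onth D q = Some (Dec i q1 q0) ->
    net_rule D K [:: pA m q; pZ q; pC i] l_zero [:: pY q0; pX m'; pC i]
| RKeep q i q1 q0 : onth D q = Some (Dec i q1 q0) ->
    net_rule D K [:: pZ q; pS q] l_zero [:: pY q0]
| RDrop q i q1 q0 : onth D q = Some (Dec i q1 q0) ->
    net_rule D K [:: pZ q; pS q] l_zero [::]
| RWitness q i q1 q0 m m' : onth D q = Some (Dec i q1 q0) ->
    net_rule D K [:: pA m q; pC i] (l_tick i) [:: pC i; pX m']
| RFake q i q1 q0 : onth D q = Some (Dec i q1 q0) ->
    net_rule D K [:: pS q] (l_tick i) [::]
| RHalt q : q < K -> onth D q = None -> net_rule D K [:: pY q; pX true] l_halt [::]
| RTick i : i < K -> net_rule D K [:: pC i] (l_tick i) [:: pC i].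

Section Abstract.

Variables (D : machine) (K : nat).
Notation net_rule := (net_rule D K).

(* None is the passage of time. *)
Inductive astep : vec * vec -> option nat -> vec * vec -> Prop :=
| Fire X Y l a l' : net_rule l a l' -> enabled X l -> astep (X, Y) (Some a) (sub X l, add l' Y)
| Tick X Y : (forall l a l', net_rule l a l' -> ~~ enabled X l) -> astep (X, Y) None (Y, vec0).

Definition counter (p : place) : bool := (p.1 == 4) && (p.2 < K).
Definition counters_only (V : vec) : Prop := forall p, ~~ counter p -> V p = 0.
Definition total (V W : vec) : nat -> nat := fun j => V (pC j) + W (pC j).

Lemma addK l V : sub (add l V) l = V.
Proof. apply: functional_extensionality => p; rewrite /sub /add; lia. Qed.

Lemma counters_only_sub V l : counters_only V -> counters_only (sub V l).
Proof. by move=> cV p /cV e; rewrite /sub e. Qed.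

Lemma counters_only_addC V i : i < K -> counters_only V -> counters_only (add [:: pC i] V).
Proof.
move=> iK cV p np; rewrite /add cV //= !addn0.
by case: eqP => // e; rewrite -e /counter /= iK in np.
Qed.


Lemma counters_only0 V : counters_only V -> (((forall q, V (pY q) = 0) * (forall m, V (pX m) = 0)) *
  ((forall q, V (pZ q) = 0) * (forall q, V (pS q) = 0) * (forall m q, V (pA m q) = 0)))%type.
Proof. by move=> cV; do !split => *; apply: cV => //; rewrite /counter; case: m. Qed.


Lemma pYE q q' : (pY q == pY q') = (q == q'). Proof. by []. Qed.
Lemma pZE q q' : (pZ q == pZ q') = (q == q'). Proof. by []. Qed.
Lemma pSE q q' : (pS q == pS q') = (q == q'). Proof. by []. Qed.
Lemma pCE q q' : (pC q == pC q') = (q == q'). Proof. by []. Qed.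
Lemma pXE m m' : (pX m == pX m') = (m == m'). Proof. by case: m m' => -[]. Qed.
Lemma pAE m m' q q' : (pA m q == pA m' q') = (m == m') && (q == q').
Proof. by case: m m' => -[]. Qed.
Definition placeE := (pYE, pZE, pSE, pCE, pXE, pAE).

Lemma total_tick V W j : 0 < V (pC j) -> total (sub V [:: pC j]) (add [:: pC j] W) = total V W.
Proof.
move=> h; apply: functional_extensionality => k; rewrite /total /sub /add /= placeE.
by case: eqP => [<-|_]; lia.
Qed.

Hypothesis D_inc : forall q i q1, onth D q = Some (Inc i q1) -> i < K /\ q1 < K.
Hypothesis D_dec : forall q i q1 q0, onth D q = Some (Dec i q1 q0) -> [/\ i < K, q1 < K & q0 < K].

Lemma halts_inc q i q1 V W : onth D q = Some (Inc i q1) ->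
  halts D (q, total V W) <-> halts D (q1, total V (add [:: pC i] W)).
Proof.
move=> e; apply: halts_step; rewrite /mstep /= e; congr (Some (_, _)).
apply: functional_extensionality => k; rewrite /set_reg /total /add /= placeE eq_sym.
by case: eqP => [<-|_]; lia.
Qed.

Lemma halts_dec q i q1 q0 V W : onth D q = Some (Dec i q1 q0) -> 0 < V (pC i) ->
  halts D (q, total V W) <-> halts D (q1, total (sub V [:: pC i]) W).
Proof.
move=> e h; apply: halts_step; rewrite /mstep /= e.
case E: (total V W i) => [|v]; first by rewrite /total in E; lia.
congr (Some (_, _)).
apply: functional_extensionality => k; rewrite /set_reg /total /sub /= placeE eq_sym.
by case: eqP => [<-|_]; rewrite /total in E; lia.
Qed.

Lemma halts_zero q i q1 q0 V W : onth D q = Some (Dec i q1 q0) ->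
  V (pC i) = 0 -> W (pC i) = 0 -> halts D (q, total V W) <-> halts D (q0, total V W).
Proof.
by move=> e h h'; apply: halts_step; rewrite /mstep /= e {1}/total h h'.
Qed.

Definition inert (X : vec) : Prop :=
  forall l a l', net_rule l a l' -> enabled X l -> exists j, l = [:: pC j].

Definition strongly_inert (X : vec) : Prop :=
  forall l a l', net_rule l a l' -> (exists j, l = [:: pC j]) \/
    exists p, [/\ p \in l, ~~ counter p & X p = 0].

Lemma strongly_inert_inert X : strongly_inert X -> inert X.
Proof.
move=> h l a l' r e; case: (h l a l' r) => // -[p [pl _ X0]].
by move/allP: e => /(_ p pl); rewrite X0.
Qed.

Lemma inert_sub X l : inert X -> inert (sub X l).
Proof.
move=> h l1 a l1' r e; apply: (h l1 a l1' r).
by apply: sub_all e => p; rewrite /sub => /leq_trans-> //; rewrite leq_subr.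
Qed.

Lemma strongly_inert_tick X j : j < K -> strongly_inert X -> strongly_inert (add [:: pC j] X).
Proof.
move=> jK h l a l' r; case: (h l a l' r) => [|[p [pl np X0]]]; first by left.
right; exists p; split=> //; rewrite /add X0 /= !addn0; case: eqP => // e.
by rewrite -e /counter /= jK in np.
Qed.

Lemma noncounter : ((forall q, ~~ counter (pY q)) * (forall m, ~~ counter (pX m)) *
  (forall q, ~~ counter (pZ q)) * (forall q, ~~ counter (pS q)) *
  (forall m q, ~~ counter (pA m q)))%type.
Proof. by do !split => //; case. Qed.

Lemma missing X l : has (fun p => ~~ counter p && (X p == 0)) l ->
  exists p, [/\ p \in l, ~~ counter p & X p = 0].
Proof. by move=> /hasP[p pl /andP[np /eqP]]; exists p. Qed.

Ltac prove_strongly_inert cV :=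
  case; try (by move=> *; left; eexists); move=> *; right; apply: missing;
  by rewrite /= ?noncounter /add /= ?(counters_only0 cV) ?eqxx ?orbT.

Lemma counters_only_sinert V : counters_only V -> strongly_inert V.
Proof. by move=> cV l a l'; prove_strongly_inert cV. Qed.

Lemma strongly_inert_Y q V : counters_only V -> strongly_inert (add [:: pY q] V).
Proof. by move=> cV l a l'; prove_strongly_inert cV. Qed.

Lemma strongly_inert_X m0 V : counters_only V -> strongly_inert (add [:: pX m0] V).
Proof. by move=> cV l a l'; prove_strongly_inert cV. Qed.

(* SimS: S stands in for a renewal of C i.  SimE: the defender has recorded the
   last renewal of C i in the marker X m.  SimDead: no state token is live.
   In SimMain the side condition excludes exactly the positions in which all
   units of the tested register have been renewed too early. *)
Inductive sim : vec * vec -> vec * vec -> Prop :=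
| SimId s : sim s s
| SimA m m' q V W : V (pS q) = 0 -> sim (add [:: pA m q] V, W) (add [:: pA m' q] V, W)
| SimS q i q1 q0 V W : onth D q = Some (Dec i q1 q0) -> counters_only V ->
    sim (add [:: pS q] V, add [:: pC i] W) (add [:: pC i] V, W)
| SimS' q i q1 q0 V W : onth D q = Some (Dec i q1 q0) -> counters_only V ->
    sim (add [:: pC i] V, W) (add [:: pS q] V, add [:: pC i] W)
| SimE m q i q1 q0 V W : onth D q = Some (Dec i q1 q0) -> counters_only V -> V (pC i) = 0 -> counters_only W ->
    sim (add [:: pA m q; pZ q; pS q] V, W) (add [:: pZ q; pS q] V, add [:: pX m] W)
| SimE' m q i q1 q0 V W : onth D q = Some (Dec i q1 q0) -> counters_only V -> V (pC i) = 0 -> counters_only W ->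
    sim (add [:: pZ q; pS q] V, add [:: pX m] W) (add [:: pA m q; pZ q; pS q] V, W)
| SimDead X Y X' Y' : inert X -> inert X' -> strongly_inert Y -> strongly_inert Y' ->
    (forall j, X (pC j) = X' (pC j)) -> (forall j, Y (pC j) = Y' (pC j)) ->
    sim (X, Y) (X', Y')
| SimPre m q V W : counters_only V -> counters_only W -> ~ halts D (q, total V W) ->
    sim (add [:: pY q; pX m] V, W) (add [:: pY q; pX (~~ m)] V, W)
| SimPost m q V W : counters_only V -> counters_only W -> ~ halts D (q, total V W) ->
    sim (V, add [:: pY q; pX m] W) (V, add [:: pY q; pX (~~ m)] W)
| SimWait m q i q1 q0 V W : onth D q = Some (Dec i q1 q0) ->
    counters_only V -> counters_only W -> ~ halts D (q, total V W) ->
    sim (V, add [:: pA m q; pZ q; pS q] W) (V, add [:: pA (~~ m) q; pZ q; pS q] W)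
| SimMain m q i q1 q0 V W : onth D q = Some (Dec i q1 q0) ->
    counters_only V -> counters_only W -> ~ halts D (q, total V W) -> 0 < V (pC i) \/ W (pC i) = 0 ->
    sim (add [:: pA m q; pZ q; pS q] V, W) (add [:: pA (~~ m) q; pZ q; pS q] V, W).

Lemma sim_sym s t : sim s t -> sim t s.
Proof.
case.
- exact: SimId.
- by move=> *; apply: SimA.
- by move=> *; apply: SimS'; eauto.
- by move=> *; apply: SimS; eauto.
- by move=> *; apply: SimE'; eauto.
- by move=> *; apply: SimE; eauto.
- by move=> *; apply: SimDead.
- move=> m q V W cV cW h; rewrite -{2}[m]negbK; exact: SimPre.
- move=> m q V W cV cW h; rewrite -{2}[m]negbK; exact: SimPost.
- move=> m q i q1 q0 V W e cV cW h; rewrite -{2}[m]negbK; exact: (SimWait _ e).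
- move=> m q i q1 q0 V W e cV cW h h'; rewrite -{2}[m]negbK; exact: (SimMain _ e).
Qed.

Lemma sim_eq X Y X' Y' A B A' B' : sim (A, B) (A', B') ->
  X = A -> Y = B -> X' = A' -> Y' = B' -> sim (X, Y) (X', Y').
Proof. by move=> h -> -> -> ->. Qed.

Lemma sim_tick s t : sim s t ->
  (forall l a l', net_rule l a l' -> ~~ enabled s.1 l) -> (forall l a l', net_rule l a l' -> ~~ enabled t.1 l) ->
  sim (s.2, vec0) (t.2, vec0).
Proof.
have c0 : counters_only vec0 by [].
have tk V j : counters_only V -> (forall l a l', net_rule l a l' -> ~~ enabled V l) -> V (pC j) = 0.
  move=> cV h; have [jK|Kj] := ltnP j K; last by apply: cV; rewrite /counter /= ltnNge Kj.
  by have := h _ _ _ (RTick D jK); rewrite /= andbT lt0n negbK => /eqP.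
have tt V W : counters_only V -> (forall l a l', net_rule l a l' -> ~~ enabled V l) -> total V W = total W vec0.
  by move=> cV h; apply: functional_extensionality => j; rewrite /total tk // addnC.
case=> /=.
- by move=> *; apply: SimId.
- by move=> *; apply: SimId.
- move=> q i q1 q0 V W e _ /(_ _ _ _ (RFake K e)); by rewrite /enabled /add /= eqxx.
- move=> q i q1 q0 V W e _ _ /(_ _ _ _ (RFake K e)); by rewrite /enabled /add /= eqxx.
- move=> m q i q1 q0 V W e _ _ _ /(_ _ _ _ (RKeep K e)); by rewrite /enabled /add /= !eqxx.
- move=> m q i q1 q0 V W e _ _ _ /(_ _ _ _ (RKeep K e)); by rewrite /enabled /add /= !eqxx.
- move=> X Y X' Y' _ _ iY iY' _ eY _ _; apply: SimDead => //; first 1 last.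
  + exact: strongly_inert_inert.
  + exact: counters_only_sinert.
  + exact: counters_only_sinert.
  + exact: strongly_inert_inert.
- by move=> *; apply: SimId.
- by move=> m q V W cV cW nh h _; apply: SimPre => //; rewrite -(tt V).
- move=> m q i q1 q0 V W e cV cW nh h _; apply: (SimMain _ e) => //; first by rewrite -(tt V).
  by right.
- by move=> *; apply: SimId.
Qed.

Definition answer (t : vec * vec) a (s' : vec * vec) : Prop :=
  exists l l', [/\ net_rule l a l', enabled t.1 l & sim s' (sub t.1 l, add l' t.2)].

Lemma answerI t a s' l l' : net_rule l a l' -> enabled t.1 l -> sim s' (sub t.1 l, add l' t.2) ->
  answer t a s'.
Proof. by exists l, l'. Qed.

Lemma enabled_add1 x l V : x \notin l -> enabled (add [:: x] V) l -> enabled V l.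
Proof.
move=> xl /allP h; apply/allP => y yl; move: (h y yl); rewrite /add /= addn0.
by case: eqP => // e; rewrite e yl in xl.
Qed.

Lemma enabled_addW l0 l V : enabled V l -> enabled (add l0 V) l.
Proof. by apply: sub_all => p; rewrite /add => /leq_trans->//; rewrite leq_addl. Qed.

Lemma sub_cons x l V : sub (add [:: x] V) (x :: l) = sub V l.
Proof. by apply: functional_extensionality => p; rewrite /sub /add /=; lia. Qed.

Lemma enabled_consE x l V : x \notin l -> enabled (add [:: x] V) (x :: l) -> enabled V l.
Proof. by move=> xl /andP[_]; exact: enabled_add1. Qed.

Lemma enabled_cons x l V : enabled V l -> enabled (add [:: x] V) (x :: l).
Proof. by move=> h; rewrite /enabled /= {1}/add /= eqxx /= -/(enabled _ _) enabled_addW. Qed.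

Lemma sim_refl X Y X' Y' : X = X' -> Y = Y' -> sim (X, Y) (X', Y').
Proof. by move=> -> ->; exact: SimId. Qed.

Lemma net_rule_tick j a l' : net_rule [:: pC j] a l' -> [/\ j < K, a = l_tick j & l' = [:: pC j]].
Proof. by move E: [:: pC j] => l r; case: r E => // i iK [->]. Qed.

Lemma net_rule_uniq l a l' : net_rule l a l' -> uniq l.
Proof. by case=> *. Qed.

Lemma sub_add_enabled l0 l V : uniq l -> enabled V l -> sub (add l0 V) l = add l0 (sub V l).
Proof.
move=> ul /allP h; apply: functional_extensionality => p; rewrite /sub /add.
rewrite (count_uniq_mem _ ul); case: (boolP (p \in l)) => [/h|]; lia.
Qed.

Lemma fire_A m m' q V W l a l' : V (pS q) = 0 -> net_rule l a l' ->
  enabled (add [:: pA m q] V) l ->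
  answer (add [:: pA m' q] V, W) a (sub (add [:: pA m q] V) l, add l' W).
Proof.
move=> VS r e; have [Al|nAl] := boolP (pA m q \in l); last first.
  have eV := enabled_add1 nAl e; apply: (answerI r); first exact: enabled_addW.
  by rewrite /= !(sub_add_enabled _ (net_rule_uniq r)) //; apply: SimA; rewrite /sub VS.
case: r Al e; move=> *.
all: match goal with H : is_true (_ \in _) |- _ => move: H; rewrite !inE ?placeE /= ?orbF //= end.
all: move=> /andP[/eqP ? /eqP ?]; subst.
all: match goal with H : is_true (enabled _ _) |- _ => have := enabled_consE _ H end.
- by move=> /(_ isT) /and4P[_]; rewrite VS.
- by move=> /(_ isT) /and3P[_]; rewrite VS.
- move=> /(_ isT) eV; 
  match goal with H : onth D _ = _ |- _ => apply: (answerI (RSwap K m' _ H)) end.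
    exact: enabled_cons.
  by rewrite !sub_cons; apply: SimId.
- move=> /(_ isT) eV; 
  match goal with H : onth D _ = _ |- _ => apply: (answerI (RWitness K m' _ H)) end.
    exact: enabled_cons.
  by rewrite !sub_cons; apply: SimId.
Qed.

Ltac vec := let p := fresh "p" in
  apply: functional_extensionality => p; rewrite /sub /add /=; lia.
Ltac vecC i := let p := fresh "p" in
  apply: functional_extensionality => p; rewrite /sub /add /=;
  case: (eqVneq (pC i) p) => [<-|_] /=; lia.
Ltac simpl_enabled cV := rewrite /enabled /add /= ?(counters_only0 cV) ?add0n ?addn0 ?lt0b ?placeE ?andbT ?eqxx /=.
Ltac invert_enabled H cV :=
  rewrite /enabled /add /= ?(counters_only0 cV) ?add0n ?addn0 ?lt0b ?placeE ?andbT /= ?andbF ?eqxx in H;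
  try by [].

Lemma fire_Pre m q V W l a l' : counters_only V -> counters_only W -> ~ halts D (q, total V W) ->
  net_rule l a l' -> enabled (add [:: pY q; pX m] V) l ->
  answer (add [:: pY q; pX (~~ m)] V, W) a (sub (add [:: pY q; pX m] V) l, add l' W).
Proof.
move=> cV cW nh [q' i q1 m' e|q' i q1 q0 m' e|q' i q1 q0 m' e|q' i q1 q0 m' e
  |q' i q1 q0 m' m2 e|q' i q1 q0 e|q' i q1 q0 e|q' i q1 q0 m' m2 e|q' i q1 q0 e|q' qK e|i iK] H.
all: invert_enabled H cV.
- case/andP: H => /eqP ? /eqP ?; subst q' m'; have [iK _] := D_inc e.
  apply: (answerI (RIncr K (~~ m) e)); first by simpl_enabled cV.
  apply: (sim_eq (SimPost m (q := q1) cV (counters_only_addC iK cW) _)); try vec.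
  by apply/(halts_inc V W e).
- case/andP: H => /eqP ? /eqP ?; subst q' m'.
  apply: (answerI (RTest K (~~ m) e)); first by simpl_enabled cV.
  by apply: (sim_eq (SimWait m e cV cW nh)); vec.
- case/andP: H => /eqP ? _; subst q'; case: nh.
  by exists (total V W 0); apply: Halt; rewrite /mstep e.
- apply: (answerI (RTick D iK)); first by simpl_enabled cV.
  apply: (sim_eq (SimPre m (q := q) (counters_only_sub [:: pC i] cV) (counters_only_addC iK cW) _)); try vecC i.
  by rewrite total_tick.
Qed.

Lemma counters_only_fire V l a l' : counters_only V -> net_rule l a l' -> enabled V l ->
  exists j, [/\ j < K, l = [:: pC j], a = l_tick j, l' = [:: pC j] & 0 < V (pC j)].
Proof.
move=> cV r H; have [j ej] := strongly_inert_inert (counters_only_sinert cV) r H; subst l.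
have [jK ? ?] := net_rule_tick r; subst; exists j; split => //.
by case/andP: H.
Qed.

Lemma fire_Post m q V W l a l' : counters_only V -> counters_only W -> ~ halts D (q, total V W) ->
  net_rule l a l' -> enabled V l ->
  answer (V, add [:: pY q; pX (~~ m)] W) a (sub V l, add l' (add [:: pY q; pX m] W)).
Proof.
move=> cV cW nh r /(counters_only_fire cV r)[j [jK ? ? ? Vj]]; subst.
apply: (answerI (RTick D jK)); first by rewrite /= Vj.
apply: (sim_eq (SimPost m (q := q) (counters_only_sub [:: pC j] cV) (counters_only_addC jK cW) _)); try vec => //.
by rewrite total_tick.
Qed.

Lemma fire_Wait m q i q1 q0 V W l a l' : onth D q = Some (Dec i q1 q0) ->
  counters_only V -> counters_only W -> ~ halts D (q, total V W) ->
  net_rule l a l' -> enabled V l ->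
  answer (V, add [:: pA (~~ m) q; pZ q; pS q] W) a
    (sub V l, add l' (add [:: pA m q; pZ q; pS q] W)).
Proof.
move=> e cV cW nh r /(counters_only_fire cV r)[j [jK ? ? ? Vj]]; subst.
apply: (answerI (RTick D jK)); first by rewrite /= Vj.
apply: (sim_eq (SimWait m e (counters_only_sub [:: pC j] cV) (counters_only_addC jK cW) _)); try vec => //.
by rewrite total_tick.
Qed.

Lemma fire_Dead X Y X' Y' l a l' : inert X -> inert X' -> strongly_inert Y -> strongly_inert Y' ->
  (forall j, X (pC j) = X' (pC j)) -> (forall j, Y (pC j) = Y' (pC j)) ->
  net_rule l a l' -> enabled X l -> answer (X', Y') a (sub X l, add l' Y).
Proof.
move=> iX iX' iY iY' eX eY r H; have [j ej] := iX _ _ _ r H; subst l.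
have [jK ? ?] := net_rule_tick r; subst.
apply: (answerI (RTick D jK)); first by rewrite /= -eX.
apply: SimDead; try exact: inert_sub; try exact: strongly_inert_tick.
- by move=> k; rewrite /sub eX.
- by move=> k; rewrite /add eY.
Qed.

Lemma fire_S q i q1 q0 V W l a l' : onth D q = Some (Dec i q1 q0) -> counters_only V ->
  net_rule l a l' -> enabled (add [:: pS q] V) l ->
  answer (add [:: pC i] V, W) a (sub (add [:: pS q] V) l, add l' (add [:: pC i] W)).
Proof.
move=> e' cV [q' i' q1' m' e|q' i' q1' q0' m' e|q' i' q1' q0' m' e|q' i' q1' q0' m' e
  |q' i' q1' q0' m' m2 e|q' i' q1' q0' e|q' i' q1' q0' e|q' i' q1' q0' m' m2 e|q' i' q1' q0' e
  |q' qK e|j jK] H.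
all: invert_enabled H cV.
- move/eqP: H => ?; subst q'; move: e; rewrite e' => -[? ? ?]; subst i' q1' q0'.
  have [iK _ _] := D_dec e'.
  apply: (answerI (RTick D iK)); first by simpl_enabled cV.
  by apply: sim_refl; vec.
- apply: (answerI (RTick D jK)); first by rewrite /= /add /=; lia.
  by apply: (sim_eq (SimS (add [:: pC j] W) e' (counters_only_sub [:: pC j] cV))); try vec; vecC j.
Qed.

Lemma fire_S' q i q1 q0 V W l a l' : onth D q = Some (Dec i q1 q0) -> counters_only V ->
  net_rule l a l' -> enabled (add [:: pC i] V) l ->
  answer (add [:: pS q] V, add [:: pC i] W) a (sub (add [:: pC i] V) l, add l' W).
Proof.
move=> e cV r; have [iK _ _] := D_dec e.
move=> /(counters_only_fire (counters_only_addC iK cV) r)[j [jK ? ? ? Vj]]; subst.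
have [Vj0|Vj0] := posnP (V (pC j)).
  have ij : i = j by move: Vj; rewrite /add /= placeE Vj0; case: eqP.
  subst j; apply: (answerI (RFake K e)); first by simpl_enabled cV.
  by apply: sim_refl; vec.
apply: (answerI (RTick D jK)); first by simpl_enabled cV.
by apply: (sim_eq (SimS' (add [:: pC j] W) e (counters_only_sub [:: pC j] cV))); try vec; vecC j.
Qed.

Lemma inert_AZ l0 m q i q1 q0 V : onth D q = Some (Dec i q1 q0) -> counters_only V -> V (pC i) = 0 ->
  {subset l0 <= [:: pA m q; pZ q]} -> inert (add l0 V).
Proof.
move=> e' cV Vi sl l a l' r H.
have {}H : enabled (add [:: pA m q; pZ q] V) l.
  apply: sub_all H => p; rewrite /add; have [/sl|] := boolP (p \in l0).
    by rewrite -has_pred1 has_count => h _; rewrite addn_gt0 h.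
  by move/count_memPn => -> ; rewrite add0n => h; rewrite addn_gt0 h orbT.
case: r H => [q' i' q1' m' e|q' i' q1' q0' m' e|q' i' q1' q0' m' e|q' i' q1' q0' m' e
  |q' i' q1' q0' m' m2 e|q' i' q1' q0' e|q' i' q1' q0' e|q' i' q1' q0' m' m2 e|q' i' q1' q0' e
  |q' qK e|j jK] H.
all: invert_enabled H cV.
- case/and3P: H => /andP[_ /eqP ?] _; subst q'; move: e; rewrite e' => -[? _ _]; subst i'.
  by rewrite Vi.
- case/andP: H => /andP[_ /eqP ?]; subst q'; move: e; rewrite e' => -[? _ _]; subst i'.
  by rewrite Vi.
- by exists j.
Qed.

Lemma fire_E m q i q1 q0 V W l a l' : onth D q = Some (Dec i q1 q0) ->
  counters_only V -> V (pC i) = 0 -> counters_only W -> net_rule l a l' -> enabled (add [:: pA m q; pZ q; pS q] V) l ->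
  answer (add [:: pZ q; pS q] V, add [:: pX m] W) a
    (sub (add [:: pA m q; pZ q; pS q] V) l, add l' W).
Proof.
move=> e' cV Vi cW [q' i' q1' m' e|q' i' q1' q0' m' e|q' i' q1' q0' m' e|q' i' q1' q0' m' e
  |q' i' q1' q0' m' m2 e|q' i' q1' q0' e|q' i' q1' q0' e|q' i' q1' q0' m' m2 e|q' i' q1' q0' e
  |q' qK e|j jK] H.
all: invert_enabled H cV.
- case/and4P: H => /andP[_ /eqP ?] _ _; subst q'; move: e; rewrite e' => -[? _ _]; subst i'.
  by rewrite Vi.
- case/and3P: H => /andP[/eqP ? /eqP ?] _ _; subst q' m'.
  move: e; rewrite e' => -[? ? ?]; subst i' q1' q0'.
  apply: (answerI (RKeep K e')); first by simpl_enabled cV.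
  by apply: sim_refl; vec.
- case/and3P: H => /andP[_ /eqP ?] _; subst q'; move: e; rewrite e' => -[? _ _]; subst i'.
  by rewrite Vi.
- case/andP: H => /eqP ? _; subst q'.
  apply: (answerI (RDrop K e')); first by simpl_enabled cV.
  apply: (sim_eq (A := add [:: pA m q] V) (A' := V) (B := add [:: pY q0'] W) (B' := add [:: pX m] W)); try vec.
  apply: SimDead.
  + by apply: (inert_AZ (m := m) e' cV Vi) => p; rewrite !inE => ->.
  + exact/strongly_inert_inert/counters_only_sinert.
  + exact: strongly_inert_Y.
  + exact: strongly_inert_X.
  + by [].
  + by [].
- case/andP: H => /eqP ? _; subst q'.
  apply: (answerI (RDrop K e')); first by simpl_enabled cV.
  apply: (sim_eq (A := add [:: pA m q] V) (A' := V) (B := W) (B' := add [:: pX m] W)); try vec.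
  apply: SimDead.
  + by apply: (inert_AZ (m := m) e' cV Vi) => p; rewrite !inE => ->.
  + exact/strongly_inert_inert/counters_only_sinert.
  + exact: counters_only_sinert.
  + exact: strongly_inert_X.
  + by [].
  + by [].
- case/andP: H => /andP[_ /eqP ?]; subst q'; move: e; rewrite e' => -[? _ _]; subst i'.
  by rewrite Vi.
- move/eqP: H => ?; subst q'; move: e; rewrite e' => -[? ? ?]; subst i' q1' q0'.
  apply: (answerI (RFake K e')); first by simpl_enabled cV.
  apply: (sim_eq (A := add [:: pA m q; pZ q] V) (A' := add [:: pZ q] V) (B := W) (B' := add [:: pX m] W)); try vec.
  apply: SimDead.
  + by apply: (inert_AZ (m := m) e' cV Vi) => p.
  + by apply: (inert_AZ (m := m) e' cV Vi) => p; rewrite !inE => ->; rewrite orbT.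
  + exact: counters_only_sinert.
  + exact: strongly_inert_X.
  + by [].
  + by [].
- apply: (answerI (RTick D jK)); first by simpl_enabled cV.
  apply: (sim_eq (SimE m e' (counters_only_sub [:: pC j] cV) _ (counters_only_addC jK cW))); try vec; try vecC j.
  by rewrite /sub Vi.
Qed.

Lemma fire_E' m q i q1 q0 V W l a l' : onth D q = Some (Dec i q1 q0) ->
  counters_only V -> V (pC i) = 0 -> counters_only W -> net_rule l a l' -> enabled (add [:: pZ q; pS q] V) l ->
  answer (add [:: pA m q; pZ q; pS q] V, W) a
    (sub (add [:: pZ q; pS q] V) l, add l' (add [:: pX m] W)).
Proof.
move=> e' cV Vi cW [q' i' q1' m' e|q' i' q1' q0' m' e|q' i' q1' q0' m' e|q' i' q1' q0' m' e
  |q' i' q1' q0' m' m2 e|q' i' q1' q0' e|q' i' q1' q0' e|q' i' q1' q0' m' m2 e|q' i' q1' q0' e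
  |q' qK e|j jK] H.
all: invert_enabled H cV.
- case/andP: H => /eqP ? _; subst q'; move: e; rewrite e' => -[? ? ?]; subst i' q1' q0'.
  apply: (answerI (RZero K m e')); first by simpl_enabled cV.
  by apply: sim_refl; vec.
- case/andP: H => /eqP ? _; subst q'.
  apply: (answerI (RDrop K e')); first by simpl_enabled cV.
  apply: (sim_eq (A' := add [:: pA m q] V) (A := V) (B' := W) (B := add [:: pX m] W)); try vec.
  apply: SimDead.
  + exact/strongly_inert_inert/counters_only_sinert.
  + by apply: (inert_AZ (m := m) e' cV Vi) => p; rewrite !inE => ->.
  + exact: strongly_inert_X.
  + exact: counters_only_sinert.
  + by [].
  + by [].
- move/eqP: H => ?; subst q'; move: e; rewrite e' => -[? ? ?]; subst i' q1' q0'.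
  apply: (answerI (RFake K e')); first by simpl_enabled cV.
  apply: (sim_eq (A' := add [:: pA m q; pZ q] V) (A := add [:: pZ q] V) (B' := W) (B := add [:: pX m] W)); try vec.
  apply: SimDead.
  + by apply: (inert_AZ (m := m) e' cV Vi) => p; rewrite !inE => ->; rewrite orbT.
  + by apply: (inert_AZ (m := m) e' cV Vi) => p.
  + exact: strongly_inert_X.
  + exact: counters_only_sinert.
  + by [].
  + by [].
- apply: (answerI (RTick D jK)); first by simpl_enabled cV.
  apply: (sim_eq (SimE' m e' (counters_only_sub [:: pC j] cV) _ (counters_only_addC jK cW))); try vec; try vecC j.
  by rewrite /sub Vi.
Qed.

Lemma fire_Main m q i q1 q0 V W l a l' : onth D q = Some (Dec i q1 q0) ->
  counters_only V -> counters_only W -> ~ halts D (q, total V W) -> 0 < V (pC i) \/ W (pC i) = 0 ->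
  net_rule l a l' -> enabled (add [:: pA m q; pZ q; pS q] V) l ->
  answer (add [:: pA (~~ m) q; pZ q; pS q] V, W) a
    (sub (add [:: pA m q; pZ q; pS q] V) l, add l' W).
Proof.
move=> e' cV cW nh hVW [q' i' q1' m' e|q' i' q1' q0' m' e|q' i' q1' q0' m' e|q' i' q1' q0' m' e
  |q' i' q1' q0' m' m2 e|q' i' q1' q0' e|q' i' q1' q0' e|q' i' q1' q0' m' m2 e|q' i' q1' q0' e
  |q' qK e|j jK] H.
all: invert_enabled H cV.
- case/and4P: H => /andP[/eqP ? /eqP ?] _ _ Vi; subst q' m'.
  move: e; rewrite e' => -[? ? ?]; subst i' q1' q0'.
  apply: (answerI (RDecr K (~~ m) e')); first by simpl_enabled cV.
  apply: (sim_eq (SimPost m (q := q1) (counters_only_sub [:: pC i] cV) cW _)); try vec.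
  by apply/(halts_dec W e').
- case/and3P: H => /andP[/eqP ? /eqP ?] _ _; subst q' m'.
  move: e; rewrite e' => -[? ? ?]; subst i' q1' q0'.
  have [Vi|Vi] := posnP (V (pC i)).
    apply: (answerI (RZero K (~~ m) e')); first by simpl_enabled cV.
    apply: (sim_eq (SimPost m (q := q0) cV cW _)); try vec.
    by apply/(halts_zero e' Vi) => //; case: hVW => //; rewrite Vi.
  apply: (answerI (RSwap K (~~ m) m e')); first by simpl_enabled cV.
  by apply: (sim_eq (SimS' (add [:: pY q0; pX m] W) e' (counters_only_sub [:: pC i] cV))); try vec; vecC i.
- case/and3P: H => /andP[/eqP ? /eqP ?] _ Vi; subst q' m'.
  move: e; rewrite e' => -[? ? ?]; subst i' q1' q0'.
  apply: (answerI (RSwap K (~~ m) m2 e')); first by simpl_enabled cV.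
  by apply: sim_refl; vec.
- case/andP: H => /eqP ? _; subst q'; move: e; rewrite e' => -[? ? ?]; subst i' q1' q0'.
  apply: (answerI (RKeep K e')); first by simpl_enabled cV.
  by apply: (sim_eq (@SimA m (~~ m) q (V) (add [:: pY q0] W) _)); try vec; rewrite (counters_only0 cV).
- case/andP: H => /eqP ? _; subst q'; move: e; rewrite e' => -[? ? ?]; subst i' q1' q0'.
  apply: (answerI (RDrop K e')); first by simpl_enabled cV.
  by apply: (sim_eq (@SimA m (~~ m) q (V) (W) _)); try vec; rewrite (counters_only0 cV).
- case/andP: H => /andP[/eqP ? /eqP ?] Vi; subst q' m'.
  move: e; rewrite e' => -[? ? ?]; subst i' q1' q0'.
  apply: (answerI (RWitness K (~~ m) m2 e')); first by simpl_enabled cV.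
  by apply: sim_refl; vec.
- move/eqP: H => ?; subst q'; move: e; rewrite e' => -[? ? ?]; subst i' q1' q0'.
  apply: (answerI (RFake K e')); first by simpl_enabled cV.
  apply: (sim_eq (@SimA m (~~ m) q (add [:: pZ q] V) (W) _)); try vec.
  by rewrite /add /= (counters_only0 cV).
- have [last|nlast] := boolP ((j == i) && (V (pC i) == 1)).
    case/andP: last => /eqP ? /eqP Vi; subst j.
    apply: (answerI (RWitness K (~~ m) m e')); first by simpl_enabled cV.
    apply: (sim_eq (SimE m e' (counters_only_sub [:: pC i] cV) _ (counters_only_addC jK cW))); try vec; try vecC i.
    by rewrite /sub Vi /= eqxx.
  apply: (answerI (RTick D jK)); first by simpl_enabled cV.
  apply: (sim_eq (SimMain m e' (counters_only_sub [:: pC j] cV) (counters_only_addC jK cW) _ _)); try vecC j.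
    by rewrite total_tick.
  move: nlast H hVW; rewrite /sub /add /= placeE; case: eqP => [->|_] /=; last by lia.
  by move=> h1 h2 _; left; lia.
Qed.

Lemma sim_fire s t l a l' : sim s t -> net_rule l a l' -> enabled s.1 l ->
  answer t a (sub s.1 l, add l' s.2).
Proof.
move=> h r; case: h => /=.
- by move=> {}s H; apply: (answerI r) => //; apply: SimId.
- by move=> *; apply: fire_A.
- by move=> *; apply: fire_S; eauto.
- by move=> *; apply: fire_S'; eauto.
- by move=> *; apply: fire_E; eauto.
- by move=> *; apply: fire_E'; eauto.
- by move=> *; apply: fire_Dead; eauto.
- by move=> *; apply: fire_Pre; eauto.
- by move=> *; apply: fire_Post; eauto.
- by move=> *; apply: fire_Wait; eauto.
- by move=> *; apply: fire_Main; eauto.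
Qed.

Lemma sim_bisim : bisimulation astep sim.
Proof.
have fwd s t a s' : sim s t -> astep s a s' -> exists2 t', astep t a t' & sim s' t'.
  move=> st h; case: h st => {s a s'} X Y.
    move=> l a l' r eX st; have [l2 [l2' [r2 e2 h2]]] := sim_fire st r eX.
    by exists (sub t.1 l2, add l2' t.2) => //; rewrite {1}[t]surjective_pairing; apply: Fire r2 e2.
  move=> nX st; have nt l a l' : net_rule l a l' -> ~~ enabled t.1 l.
    move=> r; apply/negP => et; have [l2 [l2' [r2 e2 _]]] := sim_fire (sim_sym st) r et.
    by have := nX _ _ _ r2; rewrite e2.
  exists (t.2, vec0); last exact: (sim_tick st).
  by rewrite {1}[t]surjective_pairing; apply: Tick.
move=> s t st; split=> a x hx; first exact: fwd hx.
by have [y hy /sim_sym] := fwd _ _ _ _ (sim_sym st) hx; exists y.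
Qed.

Notation abis := (bisimilar astep).

Lemma abis_fire X Y t l a l' : abis (X, Y) t -> net_rule l a l' -> enabled X l ->
  exists l2 l2', [/\ net_rule l2 a l2', enabled t.1 l2 & abis (sub X l, add l' Y) (sub t.1 l2, add l2' t.2)].
Proof.
move=> b r e; have [t' + b'] := bisimilar_fwd b (Fire Y r e).
move E: (Some a) => oa h; case: h E b' => // X' Y' l2 a' l2' r2 e2 [->] b'.
by exists l2, l2'.
Qed.

Lemma abis_tick X Y t : abis (X, Y) t -> (forall l a l', net_rule l a l' -> ~~ enabled X l) ->
  (forall l a l', net_rule l a l' -> ~~ enabled t.1 l) /\ abis (Y, vec0) (t.2, vec0).
Proof.
move=> b e; have [t' + b'] := bisimilar_fwd b (Tick Y e).
by move E: None => oa h; case: h E b'.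
Qed.

Definition addv (V W : vec) : vec := fun p => V p + W p.

Lemma drain V Y X' Y' : counters_only V -> inert X' -> abis (V, Y) (X', Y') ->
  abis (addv V Y, vec0) (addv V Y', vec0).
Proof.
move: {2}(\sum_(j < K) V (pC j)) (erefl (\sum_(j < K) V (pC j))) => n.
elim: n V Y X' Y' => [|n IH] V Y X' Y' sV cV iX b.
  have V0 : V = vec0.
    apply: functional_extensionality => -[k j].
    have [/andP[/eqP /= -> jK]|/cV //] := boolP (counter (k, j)).
    by move/eqP: sV; rewrite sum_nat_eq0 => /forallP /(_ (Ordinal jK)) /eqP.
  rewrite V0 in b *; apply: (proj2 (abis_tick b _)) => l a l' r.
  by apply/negP => /(counters_only_fire (_ : counters_only vec0) r)[//|j []].
have [j Vj] : exists j : 'I_K, 0 < V (pC j).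
  apply/existsP; rewrite -[X in is_true X]negbK negb_exists; apply/negP => /forallP h.
  by move: sV; rewrite big1 // => k _; have := h k; rewrite lt0n negbK => /eqP.
have [|l2 [l2' [r2 /= e2 b2]]] := abis_fire b (RTick D (ltn_ord j)); first by rewrite /= Vj.
have [k ek] := iX _ _ _ r2 e2; subst l2; have [kK [ekj] ?] := net_rule_tick r2; subst l2'.
rewrite -ekj in b2.
have := IH _ _ _ _ _ (counters_only_sub [:: pC j] cV) (inert_sub (l := [:: pC j]) iX) b2.
rewrite (_ : addv (sub V _) (add _ Y) = addv V Y); last first.
  by rewrite /addv; vecC (nat_of_ord j).
rewrite (_ : addv (sub V _) (add _ Y') = addv V Y'); last first.
  by rewrite /addv; vecC (nat_of_ord j).
apply; apply/eqP; rewrite -eqSS -sV (bigD1 j) //= [X in _ == X](bigD1 j) //=.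
rewrite {1}/sub /= eqxx addn0 -addSn -subSn // subSS subn0 eqn_add2l; apply/eqP.
by apply: eq_bigr => k' nk; rewrite /sub /= placeE eq_sym (inj_eq val_inj) (negbTE nk) subn0.
Qed.

Lemma abis_live q V X' Y Y' : q < K -> counters_only V -> inert X' ->
  ~ abis (add [:: pY q; pX true] V, Y) (X', Y').
Proof.
move=> qK cV iX b.
have [l [a [l' [r al eX]]]] :
    exists l a l', [/\ net_rule l a l', a < 4 & enabled (add [:: pY q; pX true] V) l].
  case e: (onth D q) => [[i q1|i q1 q0]|].
  - by do 3!eexists; split; [exact: (RIncr K true e)| |simpl_enabled cV].
  - by do 3!eexists; split; [exact: (RTest K true e)| |simpl_enabled cV].
  - by do 3!eexists; split; [exact: (RHalt qK e)| |simpl_enabled cV].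
have [l2 [l2' [r2 /= e2 _]]] := abis_fire b r eX.
by have [k ek] := iX _ _ _ r2 e2; subst l2; have [_ ea _] := net_rule_tick r2; rewrite ea in al.
Qed.

Lemma attack c y : halts_with D c y -> c.1 < K -> forall V, counters_only V ->
  (forall j, V (pC j) = c.2 j) ->
  ~ abis (add [:: pY c.1; pX true] V, vec0) (add [:: pY c.1; pX false] V, vec0).
Proof.
elim=> {c y} [[q R] /= e|[q R] c' y + _ IH] qK V cV VR b; rewrite /= in qK VR b.
  have {}e : onth D q = None.
    by move: e; rewrite /mstep /=; case: onth => // -[] // r q1 q0; case: (R r).
  have [|l2 [l2' [r2 /= e2 _]]] := abis_fire b (RHalt qK e); first by simpl_enabled cV.
  by move E: l_halt r2 e2 => a r2; case: r2 E => // q' _ _ _; simpl_enabled cV; rewrite andbF.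
rewrite /mstep /=; case e: (onth D q) => [[i q1|i q1 q0]|] //.
  move=> [E]; subst c'; have [iK q1K] := D_inc e.
  have [|l2 [l2' [r2 /= e2 b2]]] := abis_fire b (RIncr K true e); first by simpl_enabled cV.
  move E: l_tau r2 => a r2; case: r2 E e2 b2 => // [q' i' q1' m' e'|q' i' q1' q0' m' e'] _ e2 b2;
    invert_enabled e2 cV; case/andP: e2 => /eqP ? /eqP ?; subst q' m'; rewrite e in e'; last by [].
  case: e' => ? ?; subst i' q1'; rewrite !addK in b2.
  have := drain cV (strongly_inert_inert (counters_only_sinert cV)) b2.
  have nb := IH q1K (add [:: pC i] V) (counters_only_addC iK cV); rewrite /= in nb.
  rewrite (_ : addv V _ = add [:: pY q1; pX true] (add [:: pC i] V)); last by rewrite /addv /vec0; vec.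
  rewrite (_ : addv V _ = add [:: pY q1; pX false] (add [:: pC i] V)); last by rewrite /addv /vec0; vec.
  apply: nb => j; rewrite /add /set_reg /= placeE VR eq_sym; case: eqP => [->|_] /=; lia.
have [iK q1K q0K] := D_dec e.
have [|l2 [l2' [r2 /= e2 b2]]] := abis_fire b (RTest K true e); first by simpl_enabled cV.
move E: l_tau r2 => a r2; case: r2 E e2 b2 => // [q' i' q1' m' e'|q' i' q1' q0' m' e'] _ e2 b2;
  invert_enabled e2 cV; case/andP: e2 => /eqP ? /eqP ?; subst q' m'; rewrite e in e'; first by [].
case: e' => ? ? ?; subst i' q1' q0'; rewrite !addK in b2.
have {b2} := drain cV (strongly_inert_inert (counters_only_sinert cV)) b2.
rewrite (_ : addv V _ = add [:: pA true q; pZ q; pS q] V); last by rewrite /addv /vec0; vec.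
rewrite (_ : addv V _ = add [:: pA false q; pZ q; pS q] V); last by rewrite /addv /vec0; vec.
move=> {l2 l2' a} {}b; case Ri: (R i) => [|v] [E']; subst c'; last first.
  have [|l2 [l2' [r2 /= e2 b2]]] := abis_fire b (RDecr K true e); first by simpl_enabled cV; rewrite VR Ri.
  move E: l_dec r2 => a r2; case: r2 E e2 b2 => // q' i' q1' q0' m' e' _ e2 b2.
  invert_enabled e2 cV; case/and4P: e2 => /andP[/eqP ? /eqP ?] _ _ _; subst q' m'; rewrite e in e'.
  case: e' => ? ? ?; subst i' q1' q0'.
  have cV' := counters_only_sub [:: pC i] cV.
  have {b2} := drain _ _ b2.
  rewrite (_ : sub _ [:: _; _; _; _] = sub V [:: pC i]); last by vec.
  rewrite (_ : sub _ [:: _; _; _; _] = sub V [:: pC i]); last by vec.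
  move=> /(_ cV' (strongly_inert_inert (counters_only_sinert cV'))).
  rewrite (_ : addv _ _ = add [:: pY q1; pX true] (sub V [:: pC i])); last by rewrite /addv /vec0; vec.
  rewrite (_ : addv _ _ = add [:: pY q1; pX false] (sub V [:: pC i])); last by rewrite /addv /vec0; vec.
  apply: (IH q1K _ cV') => j; rewrite /sub /set_reg /= placeE VR eq_sym.
  by case: eqP => [->|_]; rewrite ?Ri; lia.
have Vi : V (pC i) = 0 by rewrite VR.
have [|l2 [l2' [r2 /= e2 b2]]] := abis_fire b (RZero K true e); first by simpl_enabled cV.
have iA : inert (add [:: pA false q] V).
  by apply: (inert_AZ (m := false) e cV Vi) => p; rewrite !inE => ->.
move: b2; rewrite addK => b2.
have V0 : addv V (add [:: pY q0; pX true] vec0) = add [:: pY q0; pX true] V.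
  by rewrite /addv /vec0; vec.
move E: l_zero r2 => a r2; case: r2 E e2 b2 => // [q' i' q1' q0' m' e'|q' i' q1' q0' m' m2 e'
  |q' i' q1' q0' e'|q' i' q1' q0' e'] _ e2 b2; invert_enabled e2 cV.
- case/and3P: e2 => /andP[/eqP ? /eqP ?] _ _; subst q' m'; rewrite e in e'.
  case: e' => ? ? ?; subst i' q1' q0'.
  have := drain cV _ b2; rewrite addK V0 => /(_ (strongly_inert_inert (counters_only_sinert cV))).
  rewrite (_ : addv V _ = add [:: pY q0; pX false] V); last by rewrite /addv /vec0; vec.
  by apply: (IH q0K).
- case/and3P: e2 => /andP[_ /eqP ?] _; subst q'; rewrite e in e'.
  by case: e' => ? _ _; subst i'; rewrite Vi.
- case/andP: e2 => /eqP ? _; subst q'; rewrite e in e'; case: e' => ? ? ?; subst i' q1' q0'.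
  have := drain cV _ b2; rewrite (_ : sub _ _ = add [:: pA false q] V); last by vec.
  rewrite V0 => /(_ iA).
  rewrite (_ : addv V _ = add [:: pY q0] V); last by rewrite /addv /vec0; vec.
  by apply: abis_live => //; apply/strongly_inert_inert/strongly_inert_Y.
- case/andP: e2 => /eqP ? _; subst q'; rewrite e in e'; case: e' => ? ? ?; subst i' q1' q0'.
  have := drain cV _ b2; rewrite (_ : sub _ _ = add [:: pA false q] V); last by vec.
  rewrite V0 => /(_ iA).
  rewrite (_ : addv V _ = V); last by rewrite /addv /vec0; vec.
  by apply: abis_live => //; apply/strongly_inert_inert/counters_only_sinert.
Qed.

Lemma halts_abis q V : q < K -> counters_only V ->
  abis (add [:: pY q; pX true] V, vec0) (add [:: pY q; pX false] V, vec0) <->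
  ~ halts D (q, fun j => V (pC j)).
Proof.
move=> qK cV; split=> [b [y h]|nh]; first exact: (attack h) b.
exists sim; first exact: sim_bisim.
apply: (@SimPre true) => //; rewrite (_ : total V vec0 = fun j => V (pC j)) //.
by apply: functional_extensionality => j; rewrite /total addn0.
Qed.

End Abstract.

Lemma net_rule_nil D K a l' : ~ net_rule D K [::] a l'.
Proof. by move E: [::] => l r; case: r E. Qed.

Section Concrete.

Variables (D : machine) (K n : nat) (N : dnet 'I_n.+1 'I_n.+1).
Notation net_rule := (net_rule D K).

Definition place_ord (p : place) : 'I_n.+1 := inord (choice.pickle p).
Definition in_range (p : place) : bool := choice.pickle p < n.+1.
Definition mkrule (r : seq place * nat * seq place) : rule 'I_n.+1 'I_n.+1 :=
  (seq_mset (map place_ord r.1.1), inord r.1.2, seq_mset (map place_ord r.2)).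

Hypothesis net_rule_range : forall l a l', net_rule l a l' -> [/\ all in_range l, a < n.+1 & all in_range l'].
Hypothesis N_rules : forall r, r \in domf (dur N) <-> exists l a l', net_rule l a l' /\ r = mkrule (l, a, l').
Hypothesis N_dur : forall r d, (dur N).[? r]%fmap = Some d -> d = 1.

Definition slice (M : marking 'I_n.+1) (t : nat) : vec :=
  fun p => if in_range p then M (place_ord p, t) else 0.

Lemma place_ord_inj p p' : in_range p -> in_range p' -> place_ord p = place_ord p' -> p = p'.
Proof.
move=> h h' /(congr1 val); rewrite /= !inordK // => e.
exact: (pcan_inj choice.pickleK).
Qed.

Definition stamped (l : seq place) (t : nat) : marking 'I_n.+1 :=
  seq_mset [seq (place_ord p, t) | p <- l].

Lemma stampedE l t p t' : all in_range l -> in_range p ->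
  stamped l t (place_ord p, t') = (t' == t) * count_mem p l.
Proof.
move=> hl hp; rewrite mset_seqE count_map; case: eqP => [->|ne] /=; last first.
  by rewrite mul0n; apply/eqP; rewrite -leqn0 leqNgt -has_count; apply/hasPn => x _ /=;
    apply/eqP => -[_ /esym].
rewrite mul1n; apply: eq_in_count => x xl /=; rewrite xpair_eqE eqxx andbT.
by apply/eqP/eqP => [/(place_ord_inj (allP hl _ xl) hp)|->].
Qed.

Lemma fireable_localP M l a l' t X : net_rule l a l' ->
  fireable_local N M (mkrule (l, a, l')) t X <-> X = stamped l t /\ enabled (slice M t) l.
Proof.
move=> r; have [hl ha hl'] := net_rule_range r; have ul := net_rule_uniq r.
split=> [[rN XM uX sX]|[-> eM]].
  have XE : X = stamped l t.
    rewrite -[X]seq_mset_id /stamped.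
    have -> : enum_mset X = [seq (k, t) | k <- [seq x.1 | x <- enum_mset X]].
      rewrite -map_comp -[LHS]map_id; apply/eq_in_map => -[k s] xX /=; congr (_, _).
      have : s \in stamps X by apply/imfsetP; exists (k, s) => //=; rewrite msuppE.
      by rewrite sX inE => /eqP.
    apply/eq_seq_msetP; rewrite (map_comp (fun k => (k, t)) place_ord); apply: perm_map.
    exact/eq_seq_msetP.
  split=> //; apply/allP => p pl; have hp := allP hl p pl.
  rewrite /slice hp; have /msubsetP/(_ (place_ord p, t)) := XM; rewrite XE.
  rewrite stampedE // eqxx mul1n; apply: leq_trans.
  by rewrite -has_count has_pred1.
split.
- by apply/N_rules; exists l, a, l'.
- apply/msubsetP => -[k s]; rewrite mset_seqE.
  have [/mapP[p pl [-> ->]]|/count_memPn-> //] := boolP ((k, s) \in [seq (place_ord p, t) | p <- l]).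
  have hp := allP hl p pl; rewrite -mset_seqE -/(stamped l t) stampedE // eqxx mul1n.
  by have := allP eM p pl; rewrite /slice hp (count_uniq_mem _ ul) pl.
- apply/eq_seq_msetP; rewrite -[X in perm_eq _ X](_ : map fst [seq (place_ord p, t) | p <- l] = _).
    by apply: perm_map; apply: perm_eq_seq_mset.
  by rewrite -map_comp.
- apply/fsetP => s; rewrite inE; apply/imfsetP/eqP => [[[k s'] /=]|->].
    by rewrite msuppE (perm_mem (perm_eq_seq_mset _)) => /mapP[p _ [_ ->]] ->.
  case: l r {hl hl' ul eM} => [/net_rule_nil//|p l r]; exists (place_ord p, t) => //=.
  by rewrite msuppE (perm_mem (perm_eq_seq_mset _)) inE eqxx.
Qed.

Lemma step_globalP M b t M' : step_global N M (b, t) M' <->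
  exists l a l', [/\ net_rule l a l', b = inord a, enabled (slice M t) l,
    (forall l1 a1 l1' t1, net_rule l1 a1 l1' -> enabled (slice M t1) l1 -> t <= t1) &
    M' = ((M `\` stamped l t) `+` stamped l' t.+1)%mset].
Proof.
split=> [[r [X [d [[fl mn] /= lr dr ->]]]]|[l [a [l' [r -> e mn ->]]]]].
  have [rN _ _ _] := fl; have [l [a [l' [rr er]]]] := (N_rules r).1 rN; subst r.
  have [-> eM] := (fireable_localP M t X rr).1 fl.
  exists l, a, l'; split=> //.
    move=> l1 a1 l1' t1 r1 e1.
    exact: (mn _ _ _ ((fireable_localP M t1 (stamped l1 t1) r1).2 (conj erefl e1))).
  rewrite (N_dur dr) addn1; congr (_ `+` _)%mset; apply/eq_seq_msetP.
  by rewrite (map_comp (fun k => (k, t.+1)) place_ord); apply/perm_map/perm_eq_seq_mset.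
have fl : fireable_local N M (mkrule (l, a, l')) t (stamped l t) by apply/fireable_localP.
have [rN _ _ _] := fl.
case dr: ((dur N).[? mkrule (l, a, l')]%fmap) => [d|]; last by move: rN; rewrite -fndSome dr.
exists (mkrule (l, a, l')), (stamped l t), d; split=> //.
  split=> // r1 t1 X1 fl1; have [rN1 _ _ _] := fl1.
  have [l1 [a1 [l1' [rr1 er1]]]] := (N_rules r1).1 rN1; subst r1.
  by apply: (mn _ _ _ _ rr1); have [] := (fireable_localP M t1 X1 rr1).1 fl1.
rewrite (N_dur dr) addn1; congr (_ `+` _)%mset; apply/eq_seq_msetP.
by rewrite (map_comp (fun k => (k, t.+1)) place_ord) perm_sym; apply/perm_map/perm_eq_seq_mset.
Qed.

Definition fire M l l' t : marking 'I_n.+1 :=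
  ((M `\` stamped l t) `+` stamped l' t.+1)%mset.

Lemma slice_fire M l l' t s : all in_range l -> all in_range l' ->
  slice (fire M l l' t) s =
  if s == t then sub (slice M t) l else if s == t.+1 then add l' (slice M t.+1) else slice M s.
Proof.
move=> hl hl'; apply: functional_extensionality => p; rewrite /slice.
have c0 l0 : all in_range l0 -> ~~ in_range p -> count_mem p l0 = 0.
  by move=> /allP h np; apply/count_memPn; apply: contra np => /h.
case: ifP => hp; last first.
  by do 2?case: eqP => _; rewrite /sub /add ?hp ?c0 ?hp.
rewrite !msetE2 !stampedE // eq_sym; case: eqP => [<-|_].
  by rewrite /sub hp ltn_eqF // mul1n mul0n addn0.
rewrite mul0n subn0 eq_sym; case: eqP => [<-|_]; last by rewrite mul0n addn0 hp.
by rewrite /add hp mul1n addnC.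
Qed.

Definition rep (t : nat) (M : marking 'I_n.+1) : Prop :=
  (forall s, t.+1 < s -> slice M s = vec0) /\
  (forall s l a l', s < t -> net_rule l a l' -> ~~ enabled (slice M s) l).

Definition state (M : marking 'I_n.+1) (t : nat) : vec * vec := (slice M t, slice M t.+1).

Lemma rep_fire t M l a l' : net_rule l a l' -> rep t M -> rep t (fire M l l' t).
Proof.
move=> /net_rule_range[hl _ hl'] [h1 h2]; split=> [s ts|s l1 a1 l1' st r1].
  by rewrite slice_fire // !gtn_eqF ?h1 // ltnW.
by rewrite slice_fire // !ltn_eqF ?(h2 _ _ _ _ st r1) // ltnW.
Qed.

Lemma state_fire t M l a l' : net_rule l a l' ->
  state (fire M l l' t) t = (sub (slice M t) l, add l' (slice M t.+1)).
Proof.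
by move=> /net_rule_range[hl _ hl']; rewrite /state !slice_fire // eqxx gtn_eqF // eqxx.
Qed.

Lemma rep_next t M : rep t M -> (forall l a l', net_rule l a l' -> ~~ enabled (slice M t) l) ->
  rep t.+1 M.
Proof.
move=> [h1 h2] nt; split=> [s ts|s l a l']; first by apply: h1; apply: ltn_trans ts.
by rewrite ltnS leq_eqVlt => /predU1P[->|lt]; [exact: nt|exact: h2].
Qed.

Lemma state_next t M : rep t M -> state M t.+1 = (slice M t.+1, vec0).
Proof. by move=> rM; rewrite /state (proj1 rM t.+2). Qed.

Lemma rep_min t M l1 a1 l1' t1 : rep t M -> net_rule l1 a1 l1' -> enabled (slice M t1) l1 -> t <= t1.
Proof.
by move=> [_ h2] r e; rewrite leqNgt; apply/negP => lt; have := h2 _ _ _ _ lt r; rewrite e.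
Qed.

Lemma step_rep t M b s M' : rep t M -> step_global N M (b, s) M' ->
  s = t \/ s = t.+1 /\ (forall l a l', net_rule l a l' -> ~~ enabled (slice M t) l).
Proof.
move=> rM /step_globalP[l [a [l' [r _ e mn _]]]].
have := rep_min rM r e; rewrite leq_eqVlt => /predU1P[->|ts]; first by left.
right; split; last first.
  move=> l1 a1 l1' r1; apply/negP => e1; have := mn _ _ _ _ r1 e1.
  by rewrite leqNgt ts.
apply/eqP; rewrite eqn_leq ts andbT leqNgt; apply/negP => /rM.1 s0.
case: l r e => [/net_rule_nil//|p l _]; by rewrite s0.
Qed.

Notation abis := (bisimilar (astep D K)).

Lemma equiv_of_abis M M' t : rep t M -> rep t M' -> abis (state M t) (state M' t) ->
  performance_equivalent N M M'.
Proof.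
pose R M M' := exists t, [/\ rep t M, rep t M' & abis (state M t) (state M' t)].
move=> rM rM' b; exists R; last by exists t.
suff fwd x y a x' : R x y -> step_global N x a x' -> exists2 y', step_global N y a y' & R x' y'.
  move=> x y xy; split=> a z h; first exact: fwd h.
  have yx : R y x by case: xy => s [? ? h1]; exists s; split=> //; apply: bisimilar_sym.
  have [z' h' [s [? ? h1]]] := fwd _ _ _ _ yx h.
  by exists z' => //; exists s; split=> //; apply: bisimilar_sym.
case: a => a s [u [rx ry bxy]] h.
have {u rx ry bxy} [rx ry bxy] : [/\ rep s x, rep s y & abis (state x s) (state y s)].
  case: (step_rep rx h) => [->//|[-> nx]].
  have [ny b'] := abis_tick bxy nx.
  split; try exact: rep_next.
  by rewrite !state_next.
move/step_globalP: h => [l [c [l' [r -> e _ ->]]]].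
have [l2 [l2' [r2 e2 b2]]] := abis_fire bxy r e.
exists (fire y l2 l2' s).
  apply/step_globalP; exists l2, c, l2'; split=> // l1 a1 l1' t1; exact: rep_min.
exists s; split; [exact: (rep_fire r)|exact: (rep_fire r2)|].
by rewrite -/(fire x l l' s) (state_fire _ _ r) (state_fire _ _ r2).
Qed.

Lemma step_fire t M l a l' : rep t M -> net_rule l a l' -> enabled (slice M t) l ->
  step_global N M (inord a, t) (fire M l l' t).
Proof.
move=> rM r e; apply/step_globalP; exists l, a, l'; split=> // l1 a1 l1' t1.
exact: rep_min.
Qed.

Lemma abis_of_equiv M M' t : rep t M -> rep t M' -> performance_equivalent N M M' ->
  abis (state M t) (state M' t).
Proof.
pose Q s s' := exists t M M', [/\ rep t M, rep t M', s = state M t, s' = state M' t &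
  performance_equivalent N M M'].
move=> rM rM' b; exists Q; last by exists t, M, M'.
suff fwd x y a x' : Q x y -> astep D K x a x' -> exists2 y', astep D K y a y' & Q x' y'.
  move=> x y xy; split=> a z h; first exact: fwd h.
  have yx : Q y x by case: xy => s [m [m' [? ? ? ? h1]]]; exists s, m', m; split=> //; apply: bisimilar_sym.
  have [z' h' [s [m [m' [? ? ? ? h1]]]]] := fwd _ _ _ _ yx h.
  by exists z' => //; exists s, m', m; split=> //; apply: bisimilar_sym.
move=> [s [m [m' [rm rm' ex -> bm]]]] h; case: h ex => {x a x'} X Y.
  move=> l a l' r e [? ?]; subst X Y.
  have [z /step_globalP[l2 [a2 [l2' [r2 ea e2 _ ->]]]] bz] :=
    bisimilar_fwd bm (step_fire rm r e).
  have {}ea : a = a2.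
    have [_ ha _] := net_rule_range r; have [_ ha2 _] := net_rule_range r2.
    by move/(congr1 val): ea; rewrite /= !inordK.
  subst a2; exists (sub (slice m' s) l2, add l2' (slice m' s.+1)); first exact: Fire.
  exists s, (fire m l l' s), (fire m' l2 l2' s); split=> //.
  - exact: (rep_fire r).
  - exact: (rep_fire r2).
  - by rewrite (state_fire _ _ r).
  - by rewrite (state_fire _ _ r2).
move=> nx [? ?]; subst X Y.
have ny l a l' : net_rule l a l' -> ~~ enabled (slice m' s) l.
  move=> r; apply/negP => e.
  have [z /step_globalP[l2 [a2 [l2' [r2 _ e2 _ _]]]] _] :=
    bisimilar_fwd (bisimilar_sym bm) (step_fire rm' r e).
  by have := nx _ _ _ r2; rewrite e2.
exists (slice m' s.+1, vec0); first exact: Tick.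
exists s.+1, m, m'; split=> //; try exact: rep_next.
- by rewrite state_next.
- by rewrite state_next.
Qed.

End Concrete.

Definition raw_rule := (seq place * nat * seq place)%type.

Definition rules_at (D : machine) (q : nat) : seq raw_rule :=
  match onth D q with
  | Some (Inc i q1) =>
      [seq ([:: pY q; pX m], l_tau, [:: pY q1; pX m; pC i]) | m <- [:: true; false]]
  | Some (Dec i q1 q0) =>
      [seq ([:: pY q; pX m], l_tau, [:: pA m q; pZ q; pS q]) | m <- [:: true; false]] ++
      [seq ([:: pA m q; pZ q; pS q; pC i], l_dec, [:: pY q1; pX m]) | m <- [:: true; false]] ++
      [seq ([:: pA m q; pZ q; pS q], l_zero, [:: pY q0; pX m]) | m <- [:: true; false]] ++
      [seq ([:: pA m q; pZ q; pC i], l_zero, [:: pY q0; pX m'; pC i])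
         | m <- [:: true; false], m' <- [:: true; false]] ++
      [:: ([:: pZ q; pS q], l_zero, [:: pY q0]); ([:: pZ q; pS q], l_zero, [::])] ++
      [seq ([:: pA m q; pC i], l_tick i, [:: pC i; pX m'])
         | m <- [:: true; false], m' <- [:: true; false]] ++
      [:: ([:: pS q], l_tick i, [::])]
  | None => [:: ([:: pY q; pX true], l_halt, [::])]
  end.

Definition rules (D : machine) (K : nat) : seq raw_rule :=
  flatten [seq rules_at D q | q <- iota 0 K] ++
  [seq ([:: pC i], l_tick i, [:: pC i]) | i <- iota 0 K].

Lemma rulesP D K l a l' : size D <= K -> (l, a, l') \in rules D K <-> net_rule D K l a l'.
Proof.
move=> DK; rewrite /rules mem_cat; split.
  case/orP => [/flattenP[s /mapP[q]]|/mapP[i]]; rewrite mem_iota /= add0n; last first.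
    by move=> iK [-> -> ->]; apply: RTick.
  move=> qK ->; rewrite /rules_at; case e: (onth D q) => [[i q1|i q1 q0]|]; rewrite !inE -?orbA.
  - by case/orP => /eqP[-> -> ->]; apply: RIncr.
  - do 16?case/orP; move=> /eqP[-> -> ->];
    first [exact: (RTest _ _ e)|exact: (RDecr _ _ e)|exact: (RZero _ _ e)|exact: (RSwap _ _ _ e)
      |exact: (RKeep _ e)|exact: (RDrop _ e)|exact: (RWitness _ _ _ e)|exact: (RFake _ e)].
  - by move=> /eqP[-> -> ->]; apply: RHalt.
have at_q q r : q < K -> r \in rules_at D q -> r \in flatten [seq rules_at D q | q <- iota 0 K].
  move=> qK h; apply/flattenP; exists (rules_at D q) => //.
  by apply: map_f; rewrite mem_iota.
have ltK q x : onth D q = Some x -> q < K.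
  by move=> e; apply: leq_trans DK; rewrite -onthTE e.
by case=> [q i q1 [] e|q i q1 q0 [] e|q i q1 q0 [] e|q i q1 q0 [] e|q i q1 q0 [] [] e
  |q i q1 q0 e|q i q1 q0 e|q i q1 q0 [] [] e|q i q1 q0 e|q qK e|i iK]; apply/orP;
  try (left; apply: (at_q q); [first [done|exact: ltK e]|by rewrite /rules_at e !inE !eqxx ?orbT]);
  right; apply: (map_f (fun i => ([:: pC i], l_tick i, [:: pC i]))); rewrite mem_iota.
Qed.

Lemma rules_at_start D K x : onth D 0 = Some x -> 
  exists a l', net_rule D K [:: pY 0; pX true] a l' /\ exists a l', net_rule D K [:: pY 0; pX false] a l'.
Proof.
case: x => [i q1|i q1 q0] e.
  by do 2!eexists; split; [exact: (RIncr K true e)|do 2!eexists; exact: (RIncr K false e)].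
by do 2!eexists; split; [exact: (RTest K true e)|do 2!eexists; exact: (RTest K false e)].
Qed.

Local Notation code := CodeSeq.code.

Definition coded_rule := (seq nat * nat * seq nat)%type.
(* Sorting makes the code of a rule a function of its multisets. *)
Definition codes (l : seq place) : seq nat := sort leq [seq choice.pickle p | p <- l].
Definition normal (r : raw_rule) : coded_rule := (codes r.1.1, r.1.2, codes r.2).
Definition nrules (D : machine) (K : nat) : seq coded_rule := undup (map normal (rules D K)).
Definition ncode (r : coded_rule) : nat := code [:: code r.1.1; r.1.2; code r.2; 1].
Definition netcode (D : machine) (K : nat) : nat := code (map ncode (nrules D K)).

Lemma mem_lt_code x s : x \in s -> x < code s.
Proof. exact: (allP (CodeSeq.ltn_code s)). Qed.

Section Net.

Variables (D : machine) (K n : nat).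
Hypothesis DK : size D <= K.
Hypothesis codeE : netcode D K = n.+1.

Lemma net_rule_in_range l a l' : net_rule D K l a l' ->
  [/\ all (in_range n) l, a < n.+1 & all (in_range n) l'].
Proof.
move=> /(rulesP _ _ _ DK) h.
have hc : ncode (normal (l, a, l')) < n.+1.
  rewrite -codeE; apply: mem_lt_code; apply: map_f.
  by rewrite mem_undup; apply: map_f.
have lt s : code s < ncode (normal (l, a, l')) -> all (fun x => x < n.+1) s.
  move=> hs; apply/allP => x /mem_lt_code xs.
  exact: ltn_trans xs (ltn_trans hs hc).
have rg l0 : all (fun x => x < n.+1) (codes l0) -> all (in_range n) l0.
  rewrite /codes (perm_all _ (permEl (perm_sort _ _))) all_map.
  by apply: sub_all.
split.
- by apply/rg/lt/mem_lt_code; rewrite inE eqxx.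
- by apply: leq_ltn_trans hc; apply: ltnW; apply: mem_lt_code; rewrite !inE eqxx orbT.
- by apply/rg/lt/mem_lt_code; rewrite !inE eqxx !orbT.
Qed.

Definition mknrule (r : coded_rule) : rule 'I_n.+1 'I_n.+1 :=
  (seq_mset (map inord r.1.1), inord r.1.2, seq_mset (map inord r.2)).

Definition canon (r : rule 'I_n.+1 'I_n.+1) : coded_rule :=
  (sort leq (map val (enum_mset (pre r))), val (lab r), sort leq (map val (enum_mset (post r)))).

Lemma mknrule_normal r : mknrule (normal r) = mkrule n r.
Proof.
have h l : seq_mset (map inord (codes l)) = seq_mset (map (place_ord n) l).
  have -> : map (place_ord n) l = map inord (map choice.pickle l) by rewrite -map_comp.
  apply/eq_seq_msetP.
  by apply: perm_map; rewrite perm_sort.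
by rewrite /mknrule /mkrule !h.
Qed.

Lemma canonK r : r \in nrules D K -> canon (mknrule r) = r.
Proof.
rewrite mem_undup => /mapP[[[l a] l'] /rulesP-/(_ DK)/net_rule_in_range[hl ha hl'] ->].
have h l0 : all (in_range n) l0 ->
    sort leq (map val (enum_mset (seq_mset (map (inord : nat -> 'I_n.+1) (codes l0))))) = codes l0.
  move=> h; apply/(perm_sortP leq_total leq_trans anti_leq).
  apply: perm_trans (perm_map _ (perm_eq_seq_mset _)) _.
  rewrite -map_comp [X in perm_eq X _](_ : _ = codes l0); first by rewrite /codes perm_sort.
  rewrite -[RHS]map_id; apply/eq_in_map => x; rewrite mem_sort => /mapP[p pl ->] /=.
  by rewrite inordK //; apply: (allP h).
by rewrite /canon /mknrule /= !h // inordK.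
Qed.

Definition netdom := [fset r in map mknrule (nrules D K)]%fset.
Definition netdur : {fmap rule 'I_n.+1 'I_n.+1 -> nat} := [fmap r : netdom => 1]%fmap.

Lemma mem_netdom r : r \in netdom <-> exists l a l', net_rule D K l a l' /\ r = mkrule n (l, a, l').
Proof.
rewrite !inE; split=> [/mapP[x]|[l [a [l' [h ->]]]]].
  rewrite mem_undup => /mapP[[[l a] l'] /rulesP-/(_ DK) h ->] ->.
  by exists l, a, l'; split=> //; rewrite mknrule_normal.
apply/mapP; exists (normal (l, a, l')); last by rewrite mknrule_normal.
by rewrite mem_undup; apply: map_f; apply/rulesP.
Qed.

Lemma netdur1 r d : netdur.[? r]%fmap = Some d -> d = 1.
Proof. by case: fndP => // kf [<-]; rewrite ffunE. Qed.

Lemma net_pre : all (fun r => pre r != mset0) (domf netdur).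
Proof.
apply/allP => r /mem_netdom[l [a [l' [h ->]]]]; apply/eqP => /msetP e.
case: l h e => [/net_rule_nil//|p l h] /(_ (place_ord n p)).
by rewrite mset0E /pre /= mset_seqE /= eqxx.
Qed.

Lemma net_dur_pos : 0 \notin codomf netdur.
Proof. by apply/codomfP => -[r /netdur1]. Qed.

Definition net : dnet 'I_n.+1 'I_n.+1 := DNet net_pre net_dur_pos.

Lemma net_codeP : net_code net n.+1.
Proof.
exists (map mknrule (nrules D K)), (fun r => ncode (canon r)); split.
- rewrite map_inj_in_uniq ?undup_uniq // => x y hx hy e.
  by rewrite -(canonK hx) -(canonK hy) e.
- by move=> r; rewrite /= !inE.
- move=> r d /netdur1 ->; rewrite /rule_code.
  have h (X : {mset 'I_n.+1}%mset) : mset_code val X (code (sort leq (map val (enum_mset X)))).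
    exists (sort (relpre val leq) (enum_mset X)); last by rewrite sort_map.
    by rewrite -[RHS]seq_mset_id; apply/eq_seq_msetP; rewrite perm_sort.
  by exists (code (canon r).1.1), (code (canon r).2); split=> //; apply: h.
- apply: etrans (esym codeE) _; rewrite /netcode; congr code; rewrite -map_comp; apply/eq_in_map => x hx /=.
  by rewrite canonK.
Qed.

Definition tcode (p : place) : nat := code [:: choice.pickle p; 0].
Definition init_places (x : nat) (m : bool) : seq place := nseq x (pC 0) ++ [:: pY 0; pX m].
Definition mcode (x : nat) (m : bool) : nat := code (map tcode (init_places x m)).

Lemma stamped_code l : all (in_range n) l ->
  mset_code (@token_code n.+1) (stamped n l 0) (code (map tcode l)).
Proof.
move=> h; exists [seq (place_ord n p, 0) | p <- l] => //; congr code; rewrite -map_comp.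
apply/eq_in_map => p pl; rewrite /= /token_code /= inordK //; exact: (allP h).
Qed.

End Net.

Lemma reduction D K x v : size D <= K -> onth D 0 = Some v ->
  (forall q i q1, onth D q = Some (Inc i q1) -> i < K /\ q1 < K) ->
  (forall q i q1 q0, onth D q = Some (Dec i q1 q0) -> [/\ i < K, q1 < K & q0 < K]) ->
  exists i, instance_code i
      (code [:: netcode D K; netcode D K; netcode D K; mcode x true; mcode x false]) /\
    (equivalent_markings i <-> ~ halts D (0, set_reg (fun=> 0) 0 x)).
Proof.
move=> DK D0 D_inc D_dec.
have K0 : 0 < K by apply: leq_trans DK; rewrite -(onthTE D 0) D0.
have [n codeE] : exists n, netcode D K = n.+1.
  exists (netcode D K).-1; rewrite prednK //.
  have /(rulesP _ _ _ DK) h := RTick D K0.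
  apply: leq_ltn_trans (leq0n _) (mem_lt_code (x := ncode (normal ([:: pC 0], l_tick 0, [:: pC 0]))) _).
  by apply: map_f; rewrite mem_undup; apply: map_f.
have rg := net_rule_in_range DK codeE.
have init_range m : all (in_range n) (init_places x m).
  have [a [l1 [r1 [b [l2 r2]]]]] := rules_at_start K D0.
  have [/and3P[hY hT _] _ _] := rg _ _ _ r1; have [/and3P[_ hF _] _ _] := rg _ _ _ r2.
  have [/andP[hC _] _ _] := rg _ _ _ (RTick D K0).
  rewrite /init_places all_cat all_nseq hC orbT /= hY /=.
  by case: m; rewrite ?hT ?hF.
pose M m := stamped n (init_places x m) 0.
exists (Instance (net n DK) (M true) (M false)); split.
  exists n.+1, (mcode x true), (mcode x false); split; rewrite ?codeE //.
  - exact: net_codeP.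
  - exact: stamped_code.
  - exact: stamped_code.
pose V : vec := fun p => (p == pC 0) * x.
have sl m s : slice (M m) s = if s == 0 then add [:: pY 0; pX m] V else vec0.
  apply: functional_extensionality => p; rewrite /slice; case: ifP => hp.
    rewrite stampedE //; case: eqP => _; last by rewrite mul0n.
    by rewrite mul1n /init_places count_cat count_nseq addnC /add /V [p == _]eq_sym.
  case: eqP => // _; have : p \notin init_places x m by apply: contraFN hp => /(allP (init_range m)).
  rewrite mem_cat negb_or => /andP[h1 h2]; rewrite /add (count_memPn h2) /V.
  by move: h1; rewrite mem_nseq negb_and -leqNgt leqn0 => /orP[/eqP->|/negbTE->] //; rewrite muln0.
have rM m : rep D K 0 (M m) by split=> // -[//|s] _; rewrite sl.
have st m : state (M m) 0 = (add [:: pY 0; pX m] V, vec0) by rewrite /state !sl.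
have cV : counters_only K V.
  by move=> p; rewrite /V; case: eqP => // -> ; rewrite /counter /= K0.
have <- : (fun j => V (pC j)) = set_reg (fun=> 0) 0 x.
  by apply: functional_extensionality => j; rewrite /V placeE /set_reg; case: eqP; rewrite ?mul1n.
rewrite -(halts_abis D_inc D_dec K0 cV) -!st; split=> h.
- exact: (abis_of_equiv (N := net n DK) rg (mem_netdom (n := n) DK) (@netdur1 D K n) (rM _) (rM _) h).
- exact: (equiv_of_abis (N := net n DK) rg (mem_netdom (n := n) DK) (@netdur1 D K n) (rM _) (rM _) h).
Qed.

Inductive cmd : Type :=
  | CInc (r : nat)
  | CSeq (c1 c2 : cmd)
  | CLoop (r : nat) (c : cmd).

Fixpoint csize (c : cmd) : nat :=
  match c with
  | CInc _ => 1
  | CSeq c1 c2 => csize c1 + csize c2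
  | CLoop _ c => (csize c).+1
  end.

Fixpoint compile (c : cmd) (o nx : nat) : machine :=
  match c with
  | CInc r => [:: Inc r nx]
  | CSeq c1 c2 => compile c1 o (o + csize c1) ++ compile c2 (o + csize c1) nx
  | CLoop r c => Dec r o.+1 nx :: compile c o.+1 o
  end.

(* The body of CLoop r may not write r, so the number of iterations is the value
   of r on entry. *)
Fixpoint eval (c : cmd) (R : nat -> nat) : nat -> nat :=
  match c with
  | CInc r => set_reg R r (R r).+1
  | CSeq c1 c2 => eval c2 (eval c1 R)
  | CLoop r c => iter (R r) (fun R' => eval c (set_reg R' r (R' r).-1)) R
  end.

Fixpoint loop_safe (c : cmd) : Prop :=
  match c with
  | CInc _ => True
  | CSeq c1 c2 => loop_safe c1 /\ loop_safe c2
  | CLoop r c => (forall R, eval c R r = R r) /\ loop_safe c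
  end.

Lemma size_compile c o nx : size (compile c o nx) = csize c.
Proof.
by elim: c o nx => //= [c1 h1 c2 h2|r c h] o nx; rewrite ?size_cat ?h1 ?h2 ?h.
Qed.

Definition embedded (E : machine) (o : nat) (s : machine) : Prop :=
  forall k, k < size s -> onth E (o + k) = onth s k.

Lemma embedded_cat E o s1 s2 :
  embedded E o (s1 ++ s2) -> embedded E o s1 /\ embedded E (o + size s1) s2.
Proof.
move=> h; split=> k hk.
  by rewrite h ?size_cat ?ltn_addr // onth_cat hk.
by rewrite -addnA h ?size_cat ?ltn_add2l // onth_cat ltnNge leq_addr /= addKn.
Qed.

Lemma embedded_cons E o x s :
  embedded E o (x :: s) -> onth E o = Some x /\ embedded E o.+1 s.
Proof.
move=> h; split=> [|k hk]; first by rewrite -[o]addn0 h.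
by rewrite addSnnS h.
Qed.

Lemma compileP E c o nx R : loop_safe c -> embedded E o (compile c o nx) ->
  halts E (o, R) <-> halts E (nx, eval c R).
Proof.
elim: c o nx R => [r|c1 IH1 c2 IH2|r c IH] o nx R /=.
- move=> _ /embedded_cons[e _]; apply: halts_step; by rewrite /mstep /= e.
- move=> [s1 s2] /embedded_cat[]; rewrite size_compile => h1 h2.
  by rewrite (IH1 _ _ _ s1 h1) (IH2 _ _ _ s2 h2).
move=> [keep s] /embedded_cons[e h].
move Ek: (R r) => k; elim: k R Ek => [|k IHk] R Ek.
  by apply: halts_step; rewrite /mstep /= e Ek.
rewrite (halts_step (c' := (o.+1, set_reg R r k))); last by rewrite /mstep /= e Ek.
rewrite (IH _ _ _ s h) iterSr Ek /=; apply: IHk.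
by rewrite keep /set_reg eqxx.
Qed.

Definition dbl (w t : nat) : cmd :=
  CSeq (CLoop w (CSeq (CInc t) (CInc t))) (CLoop t (CInc w)).
Definition push (u w t : nat) : cmd :=
  CSeq (dbl w t) (CSeq (CInc w) (CLoop u (dbl w t))).
Definition incs (k r : nat) : cmd := iter k (CSeq (CInc r)) (CInc r).

Lemma eval_incs k r R : eval (incs k r) R = set_reg R r (R r + k.+1).
Proof.
elim: k R => [|k IH] R /=; first by rewrite addn1.
rewrite IH; apply: functional_extensionality => i; rewrite /set_reg eqxx.
by case: eqP => // _; rewrite addSnnS.
Qed.

Lemma eval_dbl w t R : w != t -> R t = 0 -> eval (dbl w t) R = set_reg R w (R w).*2.
Proof.
move=> wt Rt /=; have tw : t != w by rewrite eq_sym.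
set F := fun R' => _; set G := fun R' => _.
have hF k R1 : R1 w = k -> iter k F R1 = set_reg (set_reg R1 w 0) t (R1 t + k.*2).
  elim: k R1 => [|k IH] R1 e /=.
    by apply: functional_extensionality => i; rewrite /set_reg addn0; do 2?case: eqP => [->|_].
  rewrite -iterS iterSr IH.
    apply: functional_extensionality => i; rewrite /F /set_reg /=.
    by rewrite !eqxx (negbTE tw); do 2?case: eqP => // _; lia.
  by rewrite /F /set_reg /= !eqxx (negbTE wt) e.
have hG k R1 : R1 t = k -> iter k G R1 = set_reg (set_reg R1 t 0) w (R1 w + k).
  elim: k R1 => [|k IH] R1 e /=.
    by apply: functional_extensionality => i; rewrite /set_reg addn0; do 2?case: eqP => [->|_].
  rewrite -iterS iterSr IH.
    apply: functional_extensionality => i; rewrite /G /set_reg /=.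
    by rewrite !eqxx (negbTE wt); do 2?case: eqP => // _; lia.
  by rewrite /G /set_reg /= !eqxx (negbTE tw) e.
rewrite (hF _ R erefl) (hG _ _ erefl); apply: functional_extensionality => i.
rewrite /set_reg !eqxx (negbTE wt) Rt add0n; case: eqP => // _.
by case: eqP => // ->.
Qed.

Lemma eval_push u w t R : u != w -> u != t -> w != t -> R t = 0 ->
  eval (push u w t) R = set_reg (set_reg R w (2 ^ R u * (R w).*2.+1)) u 0.
Proof.
move=> uw ut wt Rt; have wu : w != u by rewrite eq_sym.
have tw : t != w by rewrite eq_sym. have tu : t != u by rewrite eq_sym.
rewrite -[LHS]/(eval (CLoop u (dbl w t)) (eval (CInc w) (eval (dbl w t) R))) eval_dbl //.
set R0 := eval (CInc w) _.
rewrite -[LHS]/(iter (R0 u) (fun R' => eval (dbl w t) (set_reg R' u (R' u).-1)) R0).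
have hL k R1 : R1 u = k -> R1 t = 0 ->
    iter k (fun R' => eval (dbl w t) (set_reg R' u (R' u).-1)) R1 =
    set_reg (set_reg R1 w (2 ^ k * R1 w)) u 0.
  elim: k R1 => [|k IH] R1 e et.
    apply: functional_extensionality => i; rewrite /= /set_reg expn0 mul1n.
    by do 2?case: eqP => [->|_].
  rewrite iterSr IH.
  - rewrite eval_dbl //; last by rewrite /set_reg (negbTE tu).
    apply: functional_extensionality => i; rewrite /set_reg !eqxx (negbTE wu).
    by do 2?case: eqP => // _; rewrite expnS -mul2n mulnA [2 * _]mulnC.
  - by rewrite eval_dbl /set_reg ?(negbTE tu) // (negbTE uw) eqxx e.
  - by rewrite eval_dbl /set_reg ?(negbTE tu) ?(negbTE tw).
rewrite (hL _ R0 erefl); last by rewrite /R0 /= /set_reg (negbTE tw).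
rewrite /R0 /=; apply: functional_extensionality => i; rewrite /set_reg !eqxx (negbTE uw).
by do 2?case: eqP.
Qed.

Lemma iter_inv (T : Type) (P : T -> Prop) (f : T -> T) k x :
  (forall y, P y -> P (f y)) -> P x -> P (iter k f x).
Proof. by move=> h Px; elim: k => //= k; apply: h. Qed.

Fixpoint writes (c : cmd) : seq nat :=
  match c with
  | CInc r => [:: r]
  | CSeq c1 c2 => writes c1 ++ writes c2
  | CLoop r c => r :: writes c
  end.

Lemma eval_notin c R r : r \notin writes c -> eval c R r = R r.
Proof.
elim: c R => [r'|c1 IH1 c2 IH2|r' c IH] R /=.
- by rewrite inE /set_reg => /negbTE->.
- by rewrite mem_cat negb_or => /andP[h1 h2]; rewrite IH2 ?IH1.
rewrite inE negb_or => /andP[/negbTE rr' h].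
by apply: (iter_inv (P := fun R' => R' r = R r)) => // R' <-; rewrite IH // /set_reg rr'.
Qed.

Fixpoint safeb (c : cmd) : bool :=
  match c with
  | CInc _ => true
  | CSeq c1 c2 => safeb c1 && safeb c2
  | CLoop r c => (r \notin writes c) && safeb c
  end.

Lemma safeP c : safeb c -> loop_safe c.
Proof.
elim: c => //= [c1 IH1 c2 IH2 /andP[/IH1 ? /IH2 ?]//|r c IH /andP[h /IH s]].
by split=> // R; apply: eval_notin.
Qed.

Definition regs (s : seq nat) : nat -> nat := nth 0 s.

Lemma set_regs s r v : set_reg (regs s) r v = regs (set_nth 0 s r v).
Proof. by apply: functional_extensionality => i; rewrite /regs nth_set_nth. Qed.

Definition copy : cmd :=
  CLoop 0 (CSeq (CInc 1) (CSeq (CInc 2) (CSeq (CInc 3) (CSeq (CInc 4) (CInc 5))))).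

Lemma writes_incs k r : writes (incs k r) = nseq k.+1 r.
Proof. by elim: k => //= k ->. Qed.

Lemma safe_incs k r : safeb (incs k r).
Proof. by elim: k. Qed.

(* Shifted by one because [incs k r] adds k + 1. *)
Definition pushes (k d x : nat) : nat := iter x (fun m => 2 ^ k.+1 * m.*2.+1) d.+1.

Lemma code_pos a s : 0 < code (a :: s).
Proof. by rewrite /= muln_gt0 expn_gt0. Qed.

Lemma code_nseq a s x : code (nseq x a ++ s) = iter x (fun m => 2 ^ a * m.*2.+1) (code s).
Proof. by elim: x => //= x ->. Qed.

Lemma pushesE a b x : 0 < a -> 0 < b ->
  iter x (fun m => 2 ^ a * m.*2.+1) b = pushes a.-1 b.-1 x.
Proof. by move=> a0 b0; rewrite /pushes !prednK. Qed.

Lemma mcodeE : exists k (d : bool -> nat), forall x m, mcode x m = pushes k (d m) x.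
Proof.
exists (tcode (pC 0)).-1, (fun m => (code (map tcode [:: pY 0; pX m])).-1) => x m.
rewrite /mcode /init_places map_cat map_nseq code_nseq.
apply: pushesE; exact: code_pos.
Qed.

Definition marking_prog (r w k d : nat) : cmd :=
  CSeq (incs d w) (CLoop r (CSeq (incs k 7) (push 7 w 8))).

Definition instance_prog (k d1 d2 : nat) : cmd :=
  CSeq copy
  (CSeq (marking_prog 4 6 k d1)
  (CSeq (marking_prog 5 9 k d2)
  (CSeq (push 9 0 8) (CSeq (push 6 0 8) (CSeq (push 3 0 8) (CSeq (push 2 0 8) (push 1 0 8))))))).

Lemma safe_instance_prog k d1 d2 : safeb (instance_prog k d1 d2).
Proof. by rewrite /= !safe_incs !writes_incs !mem_cat !mem_nseq. Qed.

Lemma eval_copy x : eval copy (regs [:: x]) = regs [:: 0; x; x; x; x; x].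
Proof.
rewrite /=; set F := fun R' => _.
have h k a : iter k F (regs [:: k; a; a; a; a; a]) = regs [:: 0; k + a; k + a; k + a; k + a; k + a].
  elim: k a => [|k IH] a //; rewrite iterSr /F -/F !set_regs /=.
  by rewrite IH !addnS.
have -> : regs [:: x] = regs [:: x; 0; 0; 0; 0; 0].
  by apply: functional_extensionality => -[|[|[|[|[|[|i]]]]]]; rewrite /regs /= ?nth_nil.
by rewrite h addn0.
Qed.

Lemma eval_marking r w k d R : r != w -> r != 7 -> r != 8 -> w != 7 -> w != 8 ->
  R 7 = 0 -> R 8 = 0 -> R w = 0 ->
  eval (marking_prog r w k d) R = set_reg (set_reg R r 0) w (pushes k d (R r)).
Proof.
move=> rw r7 r8 w7 w8 R7 R8 Rw.
rewrite -[LHS]/(eval (CLoop r (CSeq (incs k 7) (push 7 w 8))) (eval (incs d w) R)).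
rewrite eval_incs Rw add0n; set R0 := set_reg R w _.
rewrite -[LHS]/(iter (R0 r) (fun R' => eval (push 7 w 8)
  (eval (incs k 7) (set_reg R' r (R' r).-1))) R0).
have R0r : R0 r = R r by rewrite /R0 /set_reg (negbTE rw).
set F := fun R' => _.
have FE R1 : R1 7 = 0 -> R1 8 = 0 ->
    F R1 = set_reg (set_reg R1 r (R1 r).-1) w (2 ^ k.+1 * (R1 w).*2.+1).
  move=> e7 e8; rewrite /F eval_incs eval_push //; first 1 last.
  - by rewrite eq_sym.
  - by rewrite /set_reg /= eq_sym (negbTE r8).
  apply: functional_extensionality => i.
  rewrite /set_reg eqxx [7 == r]eq_sym (negbTE r7) e7 add0n (negbTE w7) [w == r]eq_sym (negbTE rw).
  case: (eqVneq i 7) => [->|i7]; first by rewrite eq_sym (negbTE w7) eq_sym (negbTE r7) e7.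
  by [].
have h n : n <= R r -> iter n F R0 = set_reg (set_reg R0 r (R r - n)) w (pushes k d n).
  elim: n => [|n IH] nr.
    apply: functional_extensionality => i; rewrite subn0 /= /R0 /set_reg.
    by case: eqP => // _; case: eqP => [->|_].
  rewrite iterS IH 1?ltnW // FE; first 1 last.
  - by rewrite /R0 /set_reg ![7 == _]eq_sym (negbTE w7) (negbTE r7).
  - by rewrite /R0 /set_reg ![8 == _]eq_sym (negbTE w8) (negbTE r8).
  rewrite /pushes iterS -/(pushes k d n); apply: functional_extensionality => i.
  rewrite /set_reg eqxx (negbTE rw) eqxx subnS.
  by do 2?case: eqP.
rewrite R0r h // subnn; apply: functional_extensionality => i; rewrite /R0 /set_reg.
by do 2?case: eqP.
Qed.

Lemma eval_instance_prog k d1 d2 x : eval (instance_prog k d1 d2) (regs [:: x]) =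
  regs [:: code [:: x; x; x; pushes k d1 x; pushes k d2 x]].
Proof.
rewrite -[LHS]/(eval (push 1 0 8) (eval (push 2 0 8) (eval (push 3 0 8) (eval (push 6 0 8)
  (eval (push 9 0 8) (eval (marking_prog 5 9 k d2)
  (eval (marking_prog 4 6 k d1) (eval copy (regs [:: x])))))))) ).
rewrite eval_copy (eval_marking (r := 4)) // !set_regs eval_marking // !set_regs.
rewrite (eval_push (u := 9)) // !set_regs (eval_push (u := 6)) // !set_regs.
rewrite (eval_push (u := 3)) // !set_regs (eval_push (u := 2)) // !set_regs.
rewrite (eval_push (u := 1)) // !set_regs.
apply: functional_extensionality => -[|[|[|[|[|[|[|[|[|[|i]]]]]]]]]] //.
by rewrite /regs /= !nth_nil.
Qed.

Definition tgt (D : machine) (o q : nat) : nat := if q < size D then o + q else o + size D.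

Definition reloc (D : machine) (o : nat) : machine :=
  [seq match i with
       | Inc r q => Inc r (tgt D o q)
       | Dec r q q0 => Dec r (tgt D o q) (tgt D o q0)
       end | i <- D].

Lemma relocP E D o c y : embedded E o (reloc D o) -> halts_with D c y ->
  exists R, R 0 = y /\ (halts E (tgt D o c.1, c.2) <-> halts E (o + size D, R)).
Proof.
move=> emb; elim=> {c y} [[q R] /= e|[q R] c' y e _ [R' [hR' IH]]].
  exists R; split=> //; rewrite /tgt; case: ltnP => // qD.
  by move: e; rewrite /mstep /=; move: qD; rewrite -onthTE; case: onth => // -[] // r ? ?; case: (R r).
exists R'; split=> //; rewrite -IH /=; apply: halts_step.
have qD : q < size D by rewrite -onthTE; move: e; rewrite /mstep /=; case: onth.
rewrite /mstep /= {1}/tgt qD emb ?size_map // onth_map.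
move: e; rewrite /mstep /=; case: onth => // -[r q1|r q1 q0] /=.
  by move=> [<-].
by case: (R r) => [|v] [<-].
Qed.

Definition diagonal (c : cmd) (D : machine) : machine :=
  compile c 0 (csize c) ++ reloc D (csize c) ++
  [:: Dec 0 (csize c + size D).+1 (csize c + size D)].

Lemma diagonalP c D x z y : safeb c -> eval c (regs [:: x]) = regs [:: z] -> outputs D z y ->
  halts (diagonal c D) (0, set_reg (fun=> 0) 0 x) <-> 0 < y.
Proof.
move=> safe ec out; set E := diagonal c D; set o := csize c.
have : embedded E 0 E by move=> k _.
case/embedded_cat; rewrite size_compile -/o add0n => e1 /embedded_cat[e2].
rewrite size_map => /embedded_cons[e3 _].
have s0 v : set_reg (fun=> 0) 0 v = regs [:: v].
  by apply: functional_extensionality => -[|i]; rewrite /set_reg /regs //= nth_nil.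
rewrite s0 (compileP _ _ e1); last exact: safeP.
rewrite ec -s0.
have [R [R0]] := relocP e2 out; rewrite /= {1}/tgt.
have -> : (if 0 < size D then o + 0 else o + size D) = o.
  by case: (size D) => [|d]; rewrite addn0.
move=> ->; case: y R0 {out} => [|y] R0; split=> //.
- move=> [w h]; move Ec: (o + size D, R) h => d h.
  elim: h Ec => {d w} [d + Ed|d d' w + _ IH Ed]; rewrite -Ed /mstep /= e3 R0 //.
  by move=> [e]; apply: IH.
- move=> _; apply/(halts_step (c' := ((o + size D).+1, set_reg R 0 y))).
    by rewrite /mstep /= e3 R0.
  eexists; apply: Halt; rewrite /mstep onth_default //.
  by rewrite /E /diagonal !size_cat size_compile size_map /= -/o addn1 addnS.
Qed.

Definition ibound (i : instr) : nat :=
  match i with Inc r q => (r + q).+1 | Dec r q q0 => (r + q + q0).+1 end.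

Definition mbound (D : machine) : nat := size D + sumn (map ibound D).

Lemma mboundP D q i : onth D q = Some i -> ibound i <= mbound D.
Proof.
rewrite /mbound; elim: D q => [|j D IH] [|q] //= h.
  by case: h => ->; lia.
by have := IH q h; lia.
Qed.

Theorem mainTheorem2 : ~ decidable_problem instance_code equivalent_markings.
Proof.
move=> [D dec]; have [k [d codeE]] := mcodeE.
set c := instance_prog k (d true) (d false); set E := diagonal c D; set K := mbound E.
have [v E0] : exists v, onth E 0 = Some v by eexists.
have E_inc q i q1 : onth E q = Some (Inc i q1) -> i < K /\ q1 < K.
  by move/mboundP => /=; rewrite -/K; lia.
have E_dec q i q1 q0 : onth E q = Some (Dec i q1 q0) -> [/\ i < K, q1 < K & q0 < K].
  by move/mboundP => /=; rewrite -/K => h; split; lia.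
have EK : size E <= K by rewrite leq_addr.
have [I [cI hI]] := reduction (netcode E K) EK E0 E_inc E_dec.
rewrite !codeE in cI; have [yes no] := dec _ _ cI.
have EP y h := @diagonalP c D (netcode E K) _ y (safe_instance_prog _ _ _) (eval_instance_prog _ _ _ _) h.
have nI : ~ equivalent_markings I.
  by move=> h; apply: (proj1 hI h); apply/(EP 1 (yes h)).
by apply: (nI); apply/hI => h; have := proj1 (EP 0 (no nI)) h.
Qed.
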